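(* Let $p>5$ be a prime. Then: - if $p\equiv 1\pmod 8$ and $p=c^2+2d^2$ with $c,d\in\mathbb{Z}$ and $4\mid c-1$, then $$P_{[p/6]}\!\left(\frac{7\sqrt{10}}{25}\right)\equiv (-1)^{\frac d2}\left(\frac 5p\right)5^{\frac{p-1}{4}}\,2c\pmod p;$$ - if $p\equiv 3\pmod 8$ and $p=c^2+2d^2$ with $c,d\in\mathbb{Z}$ and $4\mid d-1$, then $$P_{[p/6]}\!\left(\frac{7\sqrt{10}}{25}\right)\equiv \left(\frac 5p\right)5^{\frac{p-3}{4}}\,2d\sqrt{10}\pmod p;$$ - if $p\equiv 5,7\pmod 8$, then $P_{[p/6]}\!\left(\frac{7\sqrt{10}}{25}\right)\equiv 0\pmod p$.
   Context: $\left(\frac{5}{p}\right)$ is the Legendre symbol. $[x]$ is the greatest integer not exceeding $x$. $P_n(x)$ is the $n$-th Legendre polynomial: $P_0(x)=1$, $P_1(x)=x$, $(n+1)P_{n+1}(x)=(2n+1)xP_n(x)-nP_{n-1}(x)$ for $n\ge 1$. Congruences modulo $p$ are in $R_p[\sqrt{10}]=\{u+v\sqrt{10}:u,v\in R_p\}$, where $R_p$ is the ring of rational numbers whose denominator is coprime to $p$: $\alpha\equiv\beta\pmod p$ means $\alpha-\beta\in pR_p[\sqrt{10}]$. *)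

(* Defs.v *)
From mathcomp Require Import all_boot all_order all_algebra all_field.

Set Implicit Arguments.
Unset Strict Implicit.
Unset Printing Implicit Defensive.

Import GRing.Theory Num.Theory.
Local Open Scope ring_scope.

Definition legendre_symbol (a : int) (p : nat) : int :=
  if (p %| a)%Z then 0
  else if [exists x : 'I_p, ((x : nat)%:Z ^+ 2 == a %[mod p])%Z] then 1
  else -1.

(* The Legendre polynomials P_n; legendre_polyP states the usual recurrence
   (n+1) P_(n+1) = (2n+1) X P_n - n P_(n-1), shifted by one. *)
Fixpoint legendre_poly (F : numFieldType) (n : nat) : {poly F} :=
  match n with
  | 0 => 1
  | m.+1 =>
    match m with
    | 0 => 'X
    | k.+1 => m.+1%:R^-1 *:
        ((2 * m + 1)%:R *: ('X * legendre_poly F m)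
         - m%:R *: legendre_poly F k)
    end
  end.

Lemma legendre_polyP (F : numFieldType) (n : nat) :
  n.+2%:R *: legendre_poly F n.+2 =
  (2 * n.+1 + 1)%:R *: ('X * legendre_poly F n.+1)
    - n.+1%:R *: legendre_poly F n.
Proof. by rewrite [legendre_poly F n.+2]/= scalerA divff ?pnatr_eq0 ?scale1r. Qed.

(* R_p : the rationals whose denominator is coprime to p. *)
Definition Rp (p : nat) : pred rat := fun r => coprime `|denq r|%N p.

(* R_p[sqrt 10] as a subset of algC; sqrtC 10 is the positive square root. *)
Definition Rp_sqrt10 (p : nat) (z : algC) : Prop :=
  exists u v : rat, [/\ Rp p u, Rp p v & z = ratr u + ratr v * sqrtC 10].

Definition eqmod_sqrt10 (p : nat) (a b : algC) : Prop :=
  exists2 z : algC, Rp_sqrt10 p z & a - b = p%:R * z.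

(* Main.v *)
Require Import Defs.
From HB Require Import structures.
From mathcomp Require Import all_boot all_order all_algebra all_fingroup all_field all_solvable.
From mathcomp Require Import zify ring.
Import GRing.Theory Num.Theory.
Local Open Scope ring_scope.

(** Let [N = (p - 1) / 2], let [chi] be the quadratic character of [F_p], and
    let [n] be the integer part of [p / 6]. The value of the Legendre polynomial
    is first recognised, modulo [p], as a character sum attached to an elliptic
    curve with complex multiplication by the square root of [-2]; this sum is
    then evaluated in terms of a representation [p = c^2 + 2 d^2], signs
    included.

    From Legendre to a cubic sum. Let [H_n(x; q)] be [n! P_n], homogenised so as
    to have integral coefficients ([hlegendre]). Its coefficients satisfy the
    two-term recurrence given by the differential equation of Legendre. Modulo
    [p], where [N = - 1 / 2] and [6 n = - 1] or [6 n = - 5], so do the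
    coefficients, as a polynomial in [x], of the sum over [X] of
    [(X^3 - 3 m X + 2 x)^N], with [q = m^3]. Hence the two are proportional
    ([cubic_power_sum_hlegendre]). For [m = 10] and [x = - 28] an affine change
    of variable turns the cubic into [(y + 1) (y^2 - 6 y + 1)], and
    [28 / 10^(3/2) = 7 sqrt 10 / 25]; so the Legendre value is, up to explicit
    factors, [S], the sum over [y] of [chi ((y + 1) (y^2 - 6 y + 1))]
    ([cubic_sum_hlegendre]).

    The norm equation. As in the proof by Jacobsthal of the two-square theorem,
    [S] is placed in a family: for [b] in [K = F_p[i]], [T(b)] is the sum over
    the lines spanned by [v] in [K] of [chi (N(v) Re(b v^4))]. Then
    [T(1) = 2 S], and [T(b)^2] depends only on the class of [b] modulo fourth
    powers, scalars and conjugation; it vanishes on one class. Computing the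
    sum of all the [T(b)^2] in a second way gives
    [T(1)^2 + 2 T(b)^2 = 8 p (1 + chi (-2))] for any [b] whose norm is not a
    square ([proj_sum_norm]). So [S = 0] if [p = 5, 7 mod 8]. Otherwise
    [S = 2 s] with [p = s^2 + 2 e^2], whence [s = c] or [s = - c]. The free
    action of a dihedral group of order 8 on the terms of [T(1)] that are equal
    to [-1] determines [s] modulo 4 ([cubic_sum_norm]).

    Signs. It remains to compare [2^((p - 1) / 4)] with [(-1)^(d / 2)] if
    [p = 1 mod 8] ([two_quartic]), and [2^((p - 3) / 4) s] with [d] if
    [p = 3 mod 8] ([four_power_repr]). Since [c^2 = - 2 d^2] modulo [p], both
    follow from the quadratic characters of [c] and [d] modulo [p], which
    quadratic reciprocity gives one prime factor at a time. *)

Set Implicit Arguments.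
Unset Strict Implicit.
Unset Printing Implicit Defensive.

(** * The quadratic character of a finite field *)

Section QuadraticCharacter.

Variables (F : finFieldType) (N : nat).
Hypothesis cardF : #|F| = N.*2.+1.

Lemma half_card_gt0 : (0 < N)%N.
Proof. by have := finNzRing_gt1 F; rewrite cardF; case: N. Qed.

Lemma mulrn_card : 1 *+ #|F| = 0 :> F.
Proof.
by rewrite -FinRing.zmodXgE -cardsT (expg_cardG (G := [set: F]%G)) ?inE.
Qed.

Lemma two_neq0 : 2 != 0 :> F.
Proof.
apply/eqP => two0; have := mulrn_card; rewrite cardF mulrS -mul2n mulrnA two0 mul0rn addr0 => /eqP.
by rewrite oner_eq0.
Qed.

Lemma finfield_generator : exists g : F,
  [/\ g != 0, forall x, x != 0 -> exists k, x = g ^+ k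
    & forall j, (g ^+ j == 1) = (N.*2 %| j)%N].
Proof.
have /cyclicP[u defU] := field_unit_group_cyclic [set: {unit F}]%G.
exists (\val u); split.
- by rewrite -unitfE; apply: (valP u).
- move=> x x0; have ux : x \is a GRing.unit by rewrite unitfE.
  have : (Sub x ux : {unit F}) \in <[u]>%g by rewrite -defU inE.
  case/cycleP=> k /(congr1 val) /=; rewrite FinRing.val_unitX => ->.
  by exists k.
- move=> j; have <- : #[u]%g = N.*2.
    by rewrite orderE -defU card_finField_unit cardF.
  rewrite order_dvdn -FinRing.val_unitX -(FinRing.val_unit1 F).
  by apply/eqP/eqP => [/val_inj|->].
Qed.

(** Euler's criterion is taken as the definition, so that multiplicativity and
    the congruence with [x ^+ N] are immediate. *)
Definition qchar (x : F) : int :=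
  if x == 0 then 0 else if x ^+ N == 1 then 1 else -1.

Lemma expf_double_half (x : F) : x != 0 -> x ^+ N.*2 = 1.
Proof.
move=> x0; apply: (mulfI x0); rewrite -exprS -cardF mulr1; exact: expf_card.
Qed.

Lemma expf_half (x : F) : x != 0 -> (x ^+ N == 1) || (x ^+ N == -1).
Proof.
move=> x0; rewrite -eqf_sqr expr1n -exprM muln2; exact/eqP/expf_double_half.
Qed.

Lemma opp1_neq1 : ((-1 : F) == 1) = false.
Proof. by rewrite eq_sym -subr_eq0 opprK (negPf two_neq0). Qed.

Lemma qchar_euler x : (qchar x)%:~R = x ^+ N.
Proof.
rewrite /qchar; have [->|x0] := eqVneq; first by rewrite expr0n gtn_eqF ?half_card_gt0.
by have /orP[/eqP->|/eqP->] := expf_half x0; rewrite ?eqxx ?opp1_neq1.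
Qed.

Lemma qchar0 : qchar 0 = 0. Proof. by rewrite /qchar eqxx. Qed.
Lemma qchar1 : qchar 1 = 1. Proof. by rewrite /qchar oner_eq0 expr1n eqxx. Qed.

Lemma qcharM x y : qchar (x * y) = qchar x * qchar y.
Proof.
rewrite /qchar mulf_eq0; have [->|x0] := eqVneq x 0; first by rewrite /= mul0r.
have [->|y0] /= := eqVneq y 0; first by rewrite ?mulr0.
rewrite exprMn; case/orP: (expf_half x0) => /eqP->; case/orP: (expf_half y0) => /eqP->;
by rewrite ?mulrN1 ?mulr1 ?mul1r ?opprK ?eqxx ?opp1_neq1 ?eqxx ?oppr_eq0 ?oner_eq0.
Qed.

Lemma qcharX x n : qchar (x ^+ n) = qchar x ^+ n.
Proof.
elim: n => [|n IHn]; first by rewrite !expr0 qchar1.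
by rewrite !exprS qcharM IHn.
Qed.

Lemma qchar_eq0 x : (qchar x == 0) = (x == 0).
Proof. by rewrite /qchar; case: (eqVneq x 0) => // _; case: (x ^+ N == 1). Qed.

Lemma qchar_cases x : x != 0 -> qchar x = 1 \/ qchar x = -1.
Proof. by rewrite /qchar => /negPf->; case: (x ^+ N == 1); [left|right]. Qed.

Lemma qchar_sq x : x != 0 -> qchar x ^+ 2 = 1.
Proof. by case/qchar_cases=> ->. Qed.

Lemma qchar_sqr x : x != 0 -> qchar (x ^+ 2) = 1.
Proof. by rewrite qcharX; apply: qchar_sq. Qed.

(** A converse of [qchar_euler]: [1] and [-1] are distinct in [F]. *)
Lemma qchar_inj x (e : int) : e = 1 \/ e = -1 -> x ^+ N = e%:~R -> qchar x = e.
Proof.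
move=> e_pm xN; have x0 : x != 0.
  apply: contra_eqN xN => /eqP->; rewrite expr0n gtn_eqF ?half_card_gt0 //.
  by case: e_pm => ->; rewrite eq_sym ?oppr_eq0 oner_neq0.
by rewrite /qchar (negPf x0) xN; case: e_pm => ->; rewrite ?eqxx ?opp1_neq1.
Qed.

Lemma qchar_squareP x : qchar x = 1 -> exists2 y, y != 0 & x = y ^+ 2.
Proof.
have [g [g0 gen ordg]] := finfield_generator.
rewrite /qchar; case: eqVneq => // x0.
case: ifP => // xN _; have [k def_x] := gen x x0.
move: xN; rewrite def_x -exprM ordg => /dvdnP[j kN].
exists (g ^+ j); first by rewrite expf_neq0.
rewrite -exprM; congr (_ ^+ _).
by have := half_card_gt0; nia.
Qed.

Lemma qchar_nonresidue : exists g, qchar g = -1.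
Proof.
have [g [g0 gen ordg]] := finfield_generator.
exists g; rewrite /qchar (negPf g0) ordg gtnNdvd //; have := half_card_gt0; lia.
Qed.

Lemma card_sqrt x : (#|[set t | t ^+ 2 == x]|)%:Z = 1 + qchar x.
Proof.
have [->|x0] := eqVneq x 0.
  rewrite qchar0; have -> : [set t | t ^+ 2 == 0 :> F] = [set 0].
    by apply/setP=> t; rewrite !inE expf_eq0.
  by rewrite cards1.
have [q1|qN] := qchar_cases x0; rewrite ?q1 ?qN.
  have [y y0 ->] := qchar_squareP q1.
  have -> : [set t | t ^+ 2 == y ^+ 2 :> F] = [set y; - y].
    by apply/setP=> t; rewrite !inE eqf_sqr.
  rewrite cards2 (_ : y != - y) //.
  by rewrite -subr_eq0 opprK -mulr2n -mulr_natl mulf_neq0 ?two_neq0.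
rewrite (_ : [set t | _] = set0) ?cards0 //.
apply/setP=> t; rewrite !inE; apply/eqP=> tx.
have t0 : t != 0 by apply: contraNneq x0 => t0; rewrite -tx t0 expr0n.
by have := qchar_sqr t0; rewrite tx qN.
Qed.

(** Substituting [y = t ^+ 2] weights each [y] by its number of square roots. *)
Lemma sum_over_squares (G : F -> int) :
  \sum_t G (t ^+ 2) = \sum_y (1 + qchar y) * G y.
Proof.
rewrite (partition_big (fun t : F => t ^+ 2) predT) //=; apply: eq_bigr => y _.
rewrite (eq_bigr (fun=> G y)) => [|t /eqP-> //].
rewrite sumr_const -card_sqrt -[LHS]mulr_natl natz; congr (Posz _ * _).
by apply: eq_card => t; rewrite !inE.
Qed.

Lemma sum_qchar : \sum_x qchar x = 0.
Proof.
have [g qg] := qchar_nonresidue.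
have g0 : g != 0 by rewrite -qchar_eq0 qg.
have : \sum_x qchar x = - \sum_x qchar x.
  rewrite -sumrN [LHS](reindex_inj (mulfI g0)); apply: eq_bigr => x _.
  by rewrite qcharM qg mulN1r.
lia.
Qed.

(** If [N.*2] does not divide [j], scaling the variable by a generator [g]
    multiplies the sum by [g ^+ j], which is not [1]. *)
Lemma sum_power j :
  \sum_(x : F) x ^+ j = if (0 < j)%N && (N.*2 %| j)%N then -1 else 0.
Proof.
have [g [g0 gen ordg]] := finfield_generator.
case: (posnP j) => [-> | j_gt0] /=.
  rewrite (eq_bigr (fun=> 1)) => [|x _]; last by rewrite expr0.
  by rewrite sumr_const mulrn_card.
case: ifPn => [/dvdnP[k jk]|ndv]; last first.
  have : (g ^+ j - 1) * \sum_(x : F) x ^+ j = 0.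
    rewrite mulrBl mul1r mulr_sumr [X in _ - X](reindex_inj (mulfI g0)).
    by rewrite -sumrB big1 // => x _; rewrite exprMn subrr.
  by move/eqP; rewrite mulf_eq0 subr_eq0 ordg (negPf ndv) => /eqP.
have k_gt0 : (0 < k)%N by move: j_gt0; rewrite jk muln_gt0 => /andP[].
rewrite jk mulnC (bigD1 0) //= exprM expr0n gtn_eqF ?double_gt0 ?half_card_gt0 //.
rewrite (eq_bigr (fun=> 1)) => [|x x0]; last by rewrite exprM expf_double_half ?expr1n.
rewrite sumr_const; have -> : #|[pred x : F | x != 0]| = N.*2.
  by rewrite cardC1 cardF.
rewrite expr0n; have := mulrn_card; rewrite cardF mulrS => /eqP.
rewrite addrC addr_eq0 => /eqP->.
by rewrite (gtn_eqF k_gt0) add0r.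
Qed.
End QuadraticCharacter.

(** * The ring of Gaussian elements over a finite field *)

(** The ring [F[i]] with [i ^+ 2 = -1]. It is a field only if [-1] is not a
    square in [F]; this is why units are described below by [gaussN c != 0]. The
    name hides the componentwise ring structure of pairs. *)
Definition gaussian (F : Type) : Type := (F * F)%type.

Section GaussianRing.

Variable F : finFieldType.
Local Notation K := (gaussian F).

HB.instance Definition _ := Finite.copy K (F * F)%type.
HB.instance Definition _ := GRing.Zmodule.copy K (F * F)%type.

(* Locked: otherwise simplification would unfold products in [K] under [.1]. *)
Fact gmul_key : unit. Proof. by []. Qed.
Definition gmul : K -> K -> K := locked_with gmul_key
  (fun v w => (v.1 * w.1 - v.2 * w.2, v.1 * w.2 + v.2 * w.1)).
Canonical gmul_unlockable := [unlockable fun gmul].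

Fact gmulA : associative gmul.
Proof. by case=> a b [c d] [e f]; rewrite !unlock /=; congr pair => /=; ring. Qed.

Fact gmulC : commutative gmul.
Proof. by case=> a b [c d]; rewrite !unlock /=; congr pair => /=; ring. Qed.

Fact gmul1 : left_id ((1, 0) : K) gmul.
Proof. by case=> a b; rewrite !unlock /=; congr pair => /=; ring. Qed.

Fact gmulD : left_distributive gmul +%R.
Proof. by case=> a b [c d] [e f]; rewrite !unlock /=; congr pair => /=; ring. Qed.

Fact gaussian1_neq0 : ((1, 0) : K) != 0.
Proof. by rewrite xpair_eqE oner_eq0. Qed.

HB.instance Definition _ :=
  GRing.Zmodule_isComNzRing.Build K gmulA gmulC gmul1 gmulD gaussian1_neq0.

Definition greal (x : F) : K := (x, 0).
Definition gconj (v : K) : K := (v.1, - v.2).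
Definition gaussN (v : K) : F := v.1 ^+ 2 + v.2 ^+ 2.

Lemma gmulE (v w : K) :
  v * w = (v.1 * w.1 - v.2 * w.2, v.1 * w.2 + v.2 * w.1) :> K.
Proof. by rewrite /GRing.mul /= unlock. Qed.

Lemma gaddE (v w : K) : v + w = (v.1 + w.1, v.2 + w.2) :> K.
Proof. by []. Qed.

Lemma gaussian1 : 1 = greal 1 :> K. Proof. by []. Qed.

Lemma gpow4E (v : K) : v ^+ 4 =
  (v.1 ^+ 4 - 6 * (v.1 * v.2) ^+ 2 + v.2 ^+ 4,
   4 * (v.1 * v.2 * (v.1 ^+ 2 - v.2 ^+ 2))) :> K.
Proof. by rewrite !exprS expr0 mulr1 !gmulE /=; congr pair => /=; ring. Qed.

Lemma gaussNM (v w : K) : gaussN (v * w) = gaussN v * gaussN w.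
Proof. by rewrite gmulE /gaussN /=; ring. Qed.

Lemma gaussN_real x : gaussN (greal x) = x ^+ 2.
Proof. by rewrite /gaussN /= expr0n addr0. Qed.

Lemma gaussNX (v : K) n : gaussN (v ^+ n) = gaussN v ^+ n.
Proof.
elim: n => [|n IHn]; first by rewrite !expr0 gaussian1 gaussN_real expr1n.
by rewrite !exprS gaussNM IHn.
Qed.

Lemma gaussN_conj v : gaussN (gconj v) = gaussN v.
Proof. by rewrite /gaussN /= sqrrN. Qed.

Lemma gconjM (v w : K) : gconj (v * w) = gconj v * gconj w.
Proof. by rewrite !gmulE /gconj /=; congr pair => /=; ring. Qed.

Lemma gconjK : involutive gconj.
Proof. by case=> a b; rewrite /gconj /= opprK. Qed.

Lemma mul_gconj (v : K) : gconj v * v = greal (gaussN v).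
Proof. by rewrite gmulE /gconj /greal /gaussN /=; congr pair => /=; ring. Qed.

Lemma grealM x y : greal (x * y) = greal x * greal y.
Proof. by rewrite gmulE /greal /=; congr pair => /=; ring. Qed.

Lemma re_mul_real x (v : K) : (greal x * v).1 = x * v.1.
Proof. by rewrite gmulE /=; ring. Qed.

Lemma im_mul_real x (v : K) : (greal x * v).2 = x * v.2.
Proof. by rewrite gmulE /=; ring. Qed.

Lemma gmulI (c : K) : gaussN c != 0 -> injective ( *%R c).
Proof.
move=> c0 v w /(congr1 ( *%R (gconj c))); rewrite !mulrA mul_gconj => e.
have := congr1 fst e; have := congr1 snd e; rewrite !re_mul_real !im_mul_real.
by move=> /(mulfI c0) e2 /(mulfI c0) e1; case: v w {e} e1 e2 => ? ? [? ?] /= -> ->.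
Qed.

Lemma sum_gaussian (G : K -> int) : \sum_v G v = \sum_x \sum_y G (x, y).
Proof. by rewrite pair_bigA /=; apply: eq_bigr => -[]. Qed.

End GaussianRing.

(** * The norm equation of quartic sums *)

Lemma dvdn2_card_involution (T : finType) (f : T -> T) (A : {set T}) :
  involutive f -> {in A, forall x, f x \in A} -> {in A, forall x, f x != x} ->
  (2 %| #|A|)%N.
Proof.
move=> fK; have [m] := ubnP #|A|; elim: m A => // m IHm A ltA fA ffree.
have [->|[x xA]] := set_0Vmem A; first by rewrite cards0.
have fxA : f x \in A :\ x by rewrite !inE ffree ?fA.
rewrite (cardsD1 x) xA (cardsD1 (f x)) fxA addnA dvdn_addr // IHm //.
- by move: ltA; rewrite (cardsD1 x) xA (cardsD1 (f x)) fxA; lia.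
- move=> y; rewrite !inE => /and3P[yfx yx yA].
  by rewrite fA // andbT (inj_eq (can_inj fK)) yx -{1}[x]fK (inj_eq (can_inj fK)).
- by move=> y; rewrite !inE => /and3P[_ _ /ffree].
Qed.

Section QuarticSums.

Variables (F : finFieldType) (N : nat).
Hypothesis cardF : #|F| = N.*2.+1.
Local Notation K := (gaussian F).
Local Notation chi := (@qchar F N).

(** The summand is homogeneous of even degree 6 in [v], hence constant on lines
    through the origin: [affine_sum] is [N.*2] times [proj_sum], where one vector
    is kept on each line, namely [1] and the [t + i]. *)
Definition affine_sum (b : K) : int := \sum_v chi (gaussN v) * chi (b * v ^+ 4).1.

Definition proj_sum (b : K) : int :=
  chi b.1 + \sum_t chi (t ^+ 2 + 1) * chi (b * ((t, 1) : K) ^+ 4).1.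

Lemma sum_sqr_qchar : \sum_x chi x ^+ 2 = N.*2%:Z.
Proof.
rewrite (bigD1 0) //= qchar0 expr0n add0r (eq_bigr (fun=> 1)) => [|x x0]; last first.
  exact: qchar_sq.
by rewrite sumr_const cardC1 cardF natz.
Qed.

Lemma affine_sumE b : affine_sum b = N.*2%:Z * proj_sum b.
Proof.
rewrite /affine_sum sum_gaussian exchange_big (bigD1 0) //= mulrDr; congr (_ + _).
  rewrite -sum_sqr_qchar mulr_suml; apply: eq_bigr => x _.
  have [->|x0] := eqVneq x 0.
    by rewrite /gaussN /= expr0n addr0 qchar0 !mul0r.
  have -> : gaussN ((x, 0) : K) = x ^+ 2 by rewrite -gaussN_real.
  have -> : (b * ((x, 0) : K) ^+ 4).1 = (x ^+ 2) ^+ 2 * b.1.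
    by rewrite gpow4E gmulE /=; ring.
  by rewrite [chi (_ * b.1)]qcharM // !qcharX // !qchar_sq // expr1n mul1r.
set A := \sum_t _; have -> : N.*2%:Z * A = \sum_(y : F | y != 0) A.
  by rewrite sumr_const cardC1 cardF -mulr_natl natz.
apply: eq_bigr => y y0; rewrite (reindex_inj (mulfI y0)); apply: eq_bigr => t _.
have -> : gaussN ((y * t, y) : K) = y ^+ 2 * (t ^+ 2 + 1) by rewrite /gaussN /=; ring.
have -> : (b * ((y * t, y) : K) ^+ 4).1 = (y ^+ 2) ^+ 2 * (b * ((t, 1) : K) ^+ 4).1.
  by rewrite !gpow4E !gmulE /=; ring.
by rewrite [chi (y ^+ 2 * _)]qcharM // [chi (_ * _.1)]qcharM // !qchar_sqr ?expf_neq0 // !mul1r.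
Qed.

Lemma affine_sum_mul4 b c : gaussN c != 0 ->
  affine_sum (b * c ^+ 4) = chi (gaussN c) * affine_sum b.
Proof.
move=> c0; have : affine_sum b = chi (gaussN c) * affine_sum (b * c ^+ 4).
  rewrite {1}/affine_sum (reindex_inj (gmulI c0)) mulr_sumr /=; apply: eq_bigr => v _.
  by rewrite gaussNM qcharM // exprMn !mulrA.
by move=> ->; rewrite mulrA -expr2 qchar_sq // mul1r.
Qed.

Lemma affine_sum_real x b : affine_sum (greal x * b) = chi x * affine_sum b.
Proof.
rewrite /affine_sum mulr_sumr; apply: eq_bigr => v _.
by rewrite -mulrA re_mul_real qcharM // mulrCA.
Qed.

Lemma affine_sum_conj b : affine_sum (gconj b) = affine_sum b.
Proof.
rewrite /affine_sum (reindex_inj (can_inj (@gconjK F))); apply: eq_bigr => v _.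
rewrite gaussN_conj; congr (_ * chi _).
by rewrite !gpow4E !gmulE /=; ring.
Qed.

(** Up to a rational factor, an element whose norm is a square is itself a
    square: if [gaussN b = n ^+ 2] then [(b + n) ^+ 2 = 2 (b.1 + n) b]. *)
Lemma gsquareP (b : K) : chi (gaussN b) = 1 ->
  exists x w, [/\ x != 0, gaussN w != 0 & b = greal x * w ^+ 2].
Proof.
case/(qchar_squareP cardF) => n n0 bn.
have two0 := two_neq0 cardF.
have [m m0 bm] : exists2 m, m != 0 & gaussN b = m ^+ 2 /\ b.1 + m != 0.
  have [e|] := eqVneq (b.1 + n) 0; last by exists n.
  exists (- n); rewrite ?oppr_eq0 // sqrrN; split=> //.
  have -> : b.1 = - n by apply/eqP; rewrite -addr_eq0 e.
  by rewrite -opprD oppr_eq0 -mulr2n -mulr_natl mulf_neq0.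
case: bm => bm bm0; have d0 : 2 * (b.1 + m) != 0 by rewrite mulf_neq0.
have sq : b.2 ^+ 2 = m ^+ 2 - b.1 ^+ 2 by rewrite -bm /gaussN addrC addKr.
exists (2 * (b.1 + m))^-1, (b + greal m); split; first by rewrite invr_eq0.
  suff -> : gaussN (b + greal m) = m * (2 * (b.1 + m)) by rewrite mulf_neq0.
  by rewrite gaddE /gaussN /= addr0 sq; ring.
case: b {bn bm} bm0 d0 sq => b1 b2 /= bm0 d0 sq.
rewrite gaddE expr2 !gmulE /= !(addr0, mul0r, subr0); congr pair.
  by apply: (mulfI d0); rewrite mulVKf // -!expr2 sq; ring.
by apply: (mulfI d0); rewrite mulVKf //; ring.
Qed.

Lemma affine_sum_sq_eq1 b c : chi (gaussN c) = 1 ->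
  affine_sum (b * c ^+ 2) ^+ 2 = affine_sum b ^+ 2.
Proof.
case/gsquareP=> x [w [x0 w0 ->]].
have -> : b * (greal x * w ^+ 2) ^+ 2 = greal (x ^+ 2) * (b * w ^+ 4).
  by rewrite [greal (x ^+ 2)]grealM; ring.
by rewrite affine_sum_real affine_sum_mul4 // !exprMn !qchar_sq ?expf_neq0 // !mul1r.
Qed.

(** The products of [gconj w ^+ 2] by [w ^+ 4] and of [w ^+ 2] by the square
    [gaussN w ^+ 2] are the same element: the first reading changes the sign of
    the sum, the second one does not. *)
Lemma affine_sum_sq_eq0 w : chi (gaussN w) = -1 -> affine_sum (w ^+ 2) = 0.
Proof.
move=> wN; have w0 : gaussN w != 0 by rewrite -(qchar_eq0 N) wN.
have : affine_sum (gconj w ^+ 2 * w ^+ 4) = - affine_sum (w ^+ 2).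
  rewrite affine_sum_mul4 // wN mulN1r; congr (- _).
  by rewrite -[RHS]affine_sum_conj !expr2 gconjM.
have -> : gconj w ^+ 2 * w ^+ 4 = greal (gaussN w ^+ 2) * w ^+ 2.
  by rewrite [greal _]grealM -mul_gconj; ring.
by rewrite affine_sum_real qchar_sqr // mul1r; lia.
Qed.

Definition correlation (a b : K) : int := \sum_c chi (c * a).1 * chi (c * b).1.

Lemma correlation_mul c a b : gaussN c != 0 -> correlation (c * a) (c * b) = correlation a b.
Proof.
move=> c0; rewrite /correlation [RHS](reindex_inj (gmulI c0)); apply: eq_bigr => d _.
by rewrite -!mulrA !(mulrCA c).
Qed.

Lemma sum_qchar_affine a b : b != 0 -> \sum_x chi (a - x * b) = 0.
Proof.
move=> b0; rewrite -[RHS](sum_qchar cardF) [RHS](reindex_inj (addrI a)).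
rewrite [RHS](reindex_inj oppr_inj) [RHS](reindex_inj (mulIf b0)) /=.
by [].
Qed.

Lemma correlation1 (z : K) :
  correlation 1 z = if z.2 == 0 then N.*2%:Z * #|F|%:Z * chi z.1 else 0.
Proof.
rewrite /correlation sum_gaussian; case: eqP => [z0|/eqP z0]; last first.
  rewrite big1 // => x _; rewrite (eq_bigr (fun y => chi x * chi (x * z.1 - y * z.2))).
    by rewrite -mulr_sumr sum_qchar_affine // mulr0.
  by move=> y _; rewrite mulr1 gmulE.
rewrite -mulrA -sum_sqr_qchar mulr_suml; apply: eq_bigr => x _.
rewrite (eq_bigr (fun=> chi x ^+ 2 * chi z.1)) => [|y _].
  by rewrite sumr_const -mulr_natl natz; ring.
by rewrite mulr1 gmulE z0 mulr0 subr0 (qcharM cardF) mulrA.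
Qed.

(** Only the [z] with [z ^+ 4] in [F] contribute: the multiples of [1] and [i],
    with terms [1], and those of [1 + i] and [1 - i], with terms
    [chi 2 * chi (- 4) = chi (- 2)]. *)
Lemma sum_correlation :
  \sum_z chi (gaussN z) * correlation 1 (z ^+ 4)
  = 2 * N.*2%:Z ^+ 2 * #|F|%:Z * (1 + chi (- 2%:R)).
Proof.
have two0 := two_neq0 cardF; have four0 : 4 != 0 :> F.
  by rewrite (_ : 4 = 2 * 2) ?mulf_neq0 // -natrM.
pose e (z : K) : int := if (z ^+ 4).2 == 0 then chi (gaussN z) * chi (z ^+ 4).1 else 0.
have -> : \sum_z chi (gaussN z) * correlation 1 (z ^+ 4) = N.*2%:Z * #|F|%:Z * \sum_z e z.
  rewrite mulr_sumr; apply: eq_bigr => z _; rewrite correlation1 /e.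
  by case: ifP; rewrite ?mulr0 // mulrCA.
suff -> : \sum_z e z = N.*2%:Z * 2 * (1 + chi (- 2%:R)) by ring.
have eE x y : e (x, y) = if x * y * (x ^+ 2 - y ^+ 2) == 0 then
    chi (x ^+ 2 + y ^+ 2) * chi (x ^+ 4 - 6 * (x * y) ^+ 2 + y ^+ 4) else 0.
  by rewrite /e gpow4E /= mulf_eq0 (negPf four0).
rewrite sum_gaussian (bigD1 0) //=.
have -> : \sum_y e (0, y) = N.*2%:Z.
  rewrite -sum_sqr_qchar; apply: eq_bigr => y _.
  rewrite eE !mul0r eqxx !expr0n /= mulr0 subr0 !add0r.
  have [->|y0] := eqVneq y 0; first by rewrite !expr0n !qchar0.
  by rewrite !(qcharX cardF) -[4%N]/(2 * 2)%N exprM !qchar_sq // expr1n.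
rewrite (eq_bigr (fun=> 1 + 2 * chi (- 2%:R))) => [|x x0].
  rewrite sumr_const cardC1 cardF -mulr_natl natz /=; ring.
have xN : x != - x by rewrite -subr_eq0 opprK -mulr2n -mulr_natl mulf_neq0.
rewrite (bigD1 0) //= (bigD1 x) //= (bigD1 (- x)) /=; last first.
  by rewrite oppr_eq0 x0 eq_sym.
rewrite big1 ?addr0 => [|y /andP[/andP[y0 yx] yNx]]; last first.
  by rewrite eE ifN // !mulf_neq0 // subr_eq0 eqf_sqr negb_or ![x == _]eq_sym yx eqr_oppLR yNx.
have chi4 a : a != 0 -> chi (a ^+ 4) = 1.
  by move=> a0; rewrite (qcharX cardF) -[4%N]/(2 * 2)%N exprM !qchar_sq // expr1n.
have chim4 : chi (x ^+ 2 + x ^+ 2) * chi (x ^+ 4 - 6 * (x * x) ^+ 2 + x ^+ 4) = chi (- 2%:R).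
  have -> : x ^+ 2 + x ^+ 2 = 2 * x ^+ 2 by ring.
  have -> : x ^+ 4 - 6 * (x * x) ^+ 2 + x ^+ 4 = -1 * (2 * x ^+ 2) ^+ 2 by ring.
  rewrite [chi (2 * _)](qcharM cardF) [chi (-1 * _)](qcharM cardF).
  rewrite !(qchar_sqr cardF) ?mulf_neq0 ?expf_neq0 // !mulr1.
  by rewrite mulrC -(qcharM cardF) mulN1r.
rewrite !eE !mulr0 !mul0r eqxx subrr !mulr0 eqxx sqrrN subrr mulr0 eqxx.
rewrite mulrN sqrrN exprNn -signr_odd mul1r chim4 !expr0n /= mulr0 subr0 !addr0.
by rewrite (qchar_sqr cardF) // chi4 // mul1r; ring.
Qed.

Definition gaussian_unit_card : int := \sum_(b : K | gaussN b != 0) 1.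

(** In the expanded square, the substitution [w = v * z] makes the sum over [b]
    independent of the unit [v]. *)
Lemma sum_affine_sum_sq :
  \sum_b affine_sum b ^+ 2
  = gaussian_unit_card * (2 * N.*2%:Z ^+ 2 * #|F|%:Z * (1 + chi (- 2%:R))).
Proof.
rewrite -sum_correlation /gaussian_unit_card mulr_suml.
transitivity (\sum_b \sum_v \sum_w (chi (gaussN v) * chi (gaussN w)) *
   (chi (b * v ^+ 4).1 * chi (b * w ^+ 4).1)).
  apply: eq_bigr => b _; rewrite expr2 /affine_sum mulr_suml; apply: eq_bigr => v _.
  by rewrite mulr_sumr; apply: eq_bigr => w _; ring.
rewrite exchange_big /= [RHS]big_mkcond /=; apply: eq_bigr => v _.
rewrite exchange_big /=; case: ifPn => [v0|]; last first.
  rewrite negbK => /eqP->; rewrite big1 // => w _; rewrite big1 // => b _.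
  by rewrite qchar0 !mul0r.
rewrite mul1r (reindex_inj (gmulI v0)) /=; apply: eq_bigr => z _.
rewrite -mulr_sumr gaussNM (qcharM cardF) mulrA -expr2 qchar_sq // mul1r; congr (_ * _).
have v40 : gaussN (v ^+ 4) != 0 by rewrite gaussNX expf_neq0.
by rewrite exprMn -(correlation_mul 1 _ v40) mulr1.
Qed.

(** Some [c] with [b * c = b] has a nonresidue norm, so that the sum is equal to
    its opposite. *)
Lemma affine_sum_isotropic (b : K) : gaussN b = 0 -> affine_sum b = 0.
Proof.
move=> Nb; have [b1|b1] := eqVneq b.1 0.
  have b2 : b.2 = 0 by move/eqP: Nb; rewrite /gaussN b1 expr0n add0r sqrf_eq0 => /eqP.
  by rewrite /affine_sum big1 // => v _; rewrite gmulE b1 b2 !mul0r subr0 qchar0 mulr0.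
have [g gN] := qchar_nonresidue cardF.
have two0 := two_neq0 cardF; pose s := (g - 1) / (2 * b.1).
pose c : K := 1 + greal s * gconj b.
have Nc : gaussN c = g.
  have -> : gaussN c = 1 + 2 * b.1 * s + s ^+ 2 * gaussN b.
    by rewrite /c gaddE gmulE /gaussN /=; ring.
  by rewrite Nb mulr0 addr0 /s mulrC divfK ?mulf_neq0 // addrC subrK.
have bc : b * c = b.
  by rewrite /c mulrDr mulr1 mulrCA [b * _]mulrC mul_gconj Nb -grealM mulr0 /greal addr0.
have bc4 : b * c ^+ 4 = b by rewrite !exprS expr0 mulr1 !mulrA !bc.
have := affine_sum_mul4 b (c := c); rewrite Nc bc4 gN mulN1r.
have -> : g != 0 by rewrite -(qchar_eq0 N) gN.
by move/(_ isT); lia.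
Qed.

Lemma sum_qchar_sqr_succ : \sum_t chi (t ^+ 2 + 1) = -1.
Proof.
rewrite (sum_over_squares cardF (fun y => chi (y + 1))).
under eq_bigr do rewrite mulrDl mul1r; rewrite big_split /=.
have -> : \sum_y chi (y + 1) = 0.
  by rewrite -[RHS](sum_qchar cardF) [RHS](reindex_inj (addIr 1)).
rewrite add0r (bigD1 0) //= qchar0 mul0r add0r.
rewrite (eq_bigr (fun y => chi (y^-1 + 1))) => [|y y0]; last first.
  have -> : y^-1 + 1 = (y + 1) * y / y ^+ 2 by field.
  by rewrite [RHS](qcharM cardF) -exprVn (qchar_sqr cardF) ?invr_eq0 // mulr1 (qcharM cardF) mulrC.
rewrite (reindex_inj invr_inj) /=.
rewrite (eq_big (fun y : F => y != 0) (fun y => chi (y + 1))); last 2 first.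
- by move=> y; rewrite invr_eq0.
- by move=> y _; rewrite invrK.
have : \sum_y chi (y + 1) = 0.
  by rewrite -[RHS](sum_qchar cardF) [RHS](reindex_inj (addIr 1)).
by rewrite (bigD1 0) //= add0r qchar1 => /eqP; rewrite addrC addr_eq0 => /eqP.
Qed.

Lemma gauss_nonresidue : exists w : K, chi (gaussN w) = -1.
Proof.
have [[w /eqP wN]|noN] := altP (@existsP K (fun w => chi (gaussN w) == -1)); first by exists w.
have : 0 <= \sum_t chi (t ^+ 2 + 1).
  apply: sumr_ge0 => t _; have [->|t0] := eqVneq (t ^+ 2 + 1) 0; first by rewrite qchar0.
  have [->//|tN] := qchar_cases N t0; case/existsP: noN; exists ((t, 1) : K).
  by rewrite /gaussN /= expr1n tN.
by rewrite sum_qchar_sqr_succ.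
Qed.

(** Let [w] have a nonresidue norm. If [gaussN b] is a square then one of [b],
    [w ^+ 2 * b] is, up to a scalar, a fourth power, and the other one the square
    of an element of nonresidue norm, where [affine_sum] vanishes. If [gaussN b]
    is not a square then [b] differs from [w] or from [gconj w] by a scalar and
    a fourth power. So the average of [affine_sum b ^+ 2] over the units is
    [(affine_sum 1 ^+ 2 + 2 * affine_sum w ^+ 2) / 4]. *)
Theorem proj_sum_norm : exists b : K,
  proj_sum 1 ^+ 2 + 2 * proj_sum b ^+ 2 = 8 * #|F|%:Z * (1 + chi (- 2%:R)).
Proof.
have [w wN] := gauss_nonresidue; exists w.
have w0 : gaussN w != 0 by rewrite -(qchar_eq0 N) wN.
pose h b := affine_sum b ^+ 2.
pose k : int := \sum_(b : K | chi (gaussN b) == 1) 1.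
(* Multiplication by [w] exchanges the units of residue and nonresidue norm. *)
have flip (G : K -> int) :
  \sum_(b | chi (gaussN b) == -1) G b = \sum_(b | chi (gaussN b) == 1) G (w * b).
  rewrite (reindex_inj (gmulI w0)); apply: eq_bigl => b.
  by rewrite gaussNM (qcharM cardF) wN mulN1r eqr_opp.
have split_units (G : K -> int) : \sum_(b | gaussN b != 0) G b =
    \sum_(b | chi (gaussN b) == 1) G b + \sum_(b | chi (gaussN b) == -1) G b.
  rewrite (bigID (fun b => chi (gaussN b) == 1)) /=; congr (_ + _); apply: eq_bigl => b.
    by rewrite -(qchar_eq0 N); case: eqVneq => [->|]; rewrite ?andbF.
  rewrite -(qchar_eq0 N); have [/eqP->//|] := boolP (chi (gaussN b) == 0).
  by rewrite qchar_eq0 => /(qchar_cases N)[]->.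
have k2 : gaussian_unit_card = 2 * k.
  by rewrite /gaussian_unit_card split_units flip -/k; ring.
have k_gt0 : 0 < k.
  rewrite /k (bigD1 1) /=; last by rewrite gaussian1 gaussN_real expr1n qchar1.
  by rewrite ltr_wpDr //; apply: sumr_ge0.
have hsq b c : chi (gaussN c) = 1 -> h (b * c ^+ 2) = h b.
  exact: affine_sum_sq_eq1.
have hreal x c : x != 0 -> h (greal x * c) = h c.
  by move=> x0; rewrite /h affine_sum_real exprMn qchar_sq // mul1r.
have P2 : 2 * \sum_(b | chi (gaussN b) == 1) h b = k * h 1.
  have -> : 2 * \sum_(b | chi (gaussN b) == 1) h b =
      \sum_(b | chi (gaussN b) == 1) (h b + h (w * (w * b))).
    rewrite big_split /= mulrDl mul1r; congr (_ + _).
    rewrite (reindex_inj (gmulI w0)) (reindex_inj (gmulI w0)); apply: eq_bigl => b.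
    by rewrite !gaussNM !(qcharM cardF) wN !mulN1r opprK.
  rewrite mulr_suml; apply: eq_bigr => b /eqP /gsquareP[x [v [x0 v0 ->]]].
  have -> : w * (w * (greal x * v ^+ 2)) = greal x * (w * v) ^+ 2 by ring.
  rewrite !hreal // mul1r; have [v1|vN] := qchar_cases N v0.
    rewrite -[v ^+ 2]mul1r hsq // [h ((w * v) ^+ 2)]/h affine_sum_sq_eq0 ?addr0 //.
    by rewrite gaussNM (qcharM cardF) wN v1.
  rewrite [h (v ^+ 2)]/h affine_sum_sq_eq0 // add0r -[_ ^+ 2]mul1r hsq //.
  by rewrite gaussNM (qcharM cardF) wN vN.
have M : \sum_(b | chi (gaussN b) == -1) h b = k * h w.
  rewrite flip mulr_suml; apply: eq_bigr => b /eqP b1; rewrite mul1r.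
  have [x [v [x0 v0 def_b]]] := gsquareP b1.
  rewrite def_b mulrCA hreal //; have [v1|vN] := qchar_cases N v0; first exact: hsq.
  have -> : h w = h (gconj w) by rewrite /h affine_sum_conj.
  rewrite -[RHS](hreal _ _ w0) -mul_gconj mulrAC -expr2.
  have -> : h (w * v ^+ 2) = h (greal (gaussN w) * (w * v ^+ 2)) by rewrite hreal.
  have -> : greal (gaussN w) * (w * v ^+ 2) = gconj w * (w * v) ^+ 2.
    by rewrite -mul_gconj; ring.
  rewrite hsq; last by rewrite gaussNM (qcharM cardF) wN vN.
  have -> : gconj w ^+ 2 * w = greal (gaussN w) * gconj w.
    by rewrite -mul_gconj; ring.
  by rewrite hreal.
have := sum_affine_sum_sq; rewrite k2.
have -> : \sum_b affine_sum b ^+ 2 = \sum_(b | gaussN b != 0) h b.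
  rewrite [RHS]big_mkcond /=; apply: eq_bigr => b _; case: ifPn => //.
  by rewrite negbK => /eqP/affine_sum_isotropic->.
rewrite split_units M => total; have N0 := half_card_gt0 cardF.
apply: (mulfI (x := k * N.*2%:Z ^+ 2)).
  have N2 : N.*2%:Z != 0 by rewrite eqz_nat double_eq0 -lt0n.
  by rewrite mulf_neq0 ?expf_neq0 // lt0r_neq0.
have -> : k * N.*2%:Z ^+ 2 * (proj_sum 1 ^+ 2 + 2 * proj_sum w ^+ 2) = k * h 1 + 2 * (k * h w).
  by rewrite /h !affine_sumE; ring.
rewrite -P2 -mulrDr total; ring.
Qed.

(** * The cubic sum *)

(** The curve [Y ^+ 2 = (y + 1) * (y ^+ 2 - 6 * y + 1)] has complex
    multiplication by the square root of [-2]; its number of points over [F] is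
    [#|F| + 1 + cubic_sum]. *)
Definition cubic_sum : int := \sum_y chi ((y + 1) * (y ^+ 2 - 6 * y + 1)).

(** The value of [N(v) * Re(v ^+ 4)] at [v = t + i]. *)
Definition sextic (t : F) : F := (t ^+ 2 + 1) * (t ^+ 4 - 6 * t ^+ 2 + 1).

Lemma proj_sum1E : proj_sum 1 = 1 + \sum_t chi (sextic t).
Proof.
rewrite /proj_sum /= qchar1; congr (_ + _); apply: eq_bigr => t _.
by rewrite mul1r -(qcharM cardF) gpow4E /= !expr1n mulr1.
Qed.

(** With [y = t ^+ 2] the sextic becomes the cubic, each [y] having weight
    [1 + chi y]; by the symmetry [y |-> y^-1] both terms of the weight give
    [cubic_sum], up to the term at [y = 0]. *)
Lemma proj_sum1_cubic : proj_sum 1 = 2 * cubic_sum.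
Proof.
pose f (y : F) := (y + 1) * (y ^+ 2 - 6 * y + 1).
have f0 : chi (f 0) = 1 by rewrite /f -[RHS](qchar1 F N); congr chi; ring.
rewrite proj_sum1E (eq_bigr (fun t => chi (f (t ^+ 2)))); last first.
  by move=> t _; congr chi; rewrite /sextic /f; ring.
rewrite (sum_over_squares cardF (fun y => chi (f y))).
under eq_bigr do rewrite mulrDl mul1r -(qcharM cardF); rewrite big_split /=.
suff e : \sum_y chi (y * f y) = cubic_sum - 1 by rewrite e -/cubic_sum; ring.
have -> : cubic_sum = chi (f 0) + \sum_(y | y != 0) chi (f y) by rewrite /cubic_sum (bigD1 0).
rewrite f0 addrAC subrr add0r (bigD1 0) //= mul0r qchar0 add0r.
rewrite (reindex_inj invr_inj) /=; apply: eq_big => [y|y]; rewrite ?invr_eq0 // => y0.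
have -> : y^-1 * f y^-1 = (y ^- 2) ^+ 2 * f y by rewrite /f; field.
by rewrite (qcharM cardF) (qchar_sqr cardF) ?mul1r // invr_eq0 expf_neq0.
Qed.

Section Symmetry.

Hypothesis chim2 : chi (- 2%:R) = 1.

Lemma sextic_invariances t : chi (sextic t) = -1 ->
  [/\ t != 0, t ^+ 2 != 1, t ^+ 2 != -1 & t ^+ 4 - 6 * t ^+ 2 + 1 != 0] /\
  [/\ chi (sextic (- t)) = -1, chi (sextic t^-1) = -1
    & chi (sextic ((1 - t) / (1 + t))) = -1].
Proof.
move=> tX; have two0 := two_neq0 cardF.
have t0 : t != 0.
  apply/eqP => t0; have : chi (sextic t) = 1.
    by rewrite t0 -(qchar1 F N); congr chi; rewrite /sextic; ring.
  by rewrite tX.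
have t1 : t ^+ 2 != 1.
  apply/eqP => t1; have : chi (sextic t) = 1.
    have -> : sextic t = - 2%:R * 2 ^+ 2.
      by rewrite /sextic -[4%N]/(2 * 2)%N exprM t1; ring.
    by rewrite (qcharM cardF) chim2 (qchar_sqr cardF).
  by rewrite tX.
have s0 : sextic t != 0 by rewrite -(qchar_eq0 N) tX.
have ti : t ^+ 2 != -1.
  by apply: contraNneq s0 => e; rewrite /sextic e addNr mul0r.
have tq : t ^+ 4 - 6 * t ^+ 2 + 1 != 0.
  by apply: contraNneq s0 => e; rewrite /sextic e mulr0.
split; split=> //.
- by rewrite -tX; congr chi; rewrite /sextic; ring.
- have -> : sextic t^-1 = (t ^- 3) ^+ 2 * sextic t by rewrite /sextic; field.
  by rewrite (qcharM cardF) tX (qchar_sqr cardF) ?mul1r // invr_eq0 expf_neq0.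
- have u0 : 1 + t != 0.
    by apply: contraNneq t1 => e; rewrite sqrf_eq1 -[t == -1]addr_eq0 [t + 1]addrC e eqxx orbT.
  have -> : sextic ((1 - t) / (1 + t)) = (2 * (1 + t) ^- 3) ^+ 2 * (- 2%:R * sextic t).
    by rewrite /sextic; field.
  rewrite (qcharM cardF) [chi (_ * sextic t)](qcharM cardF) tX chim2.
  by rewrite (qchar_sqr cardF) ?mul1r // mulf_neq0 // invr_eq0 expf_neq0.
Qed.

(** The eight maps generated by [t |-> - t], [t |-> 1 / t] and
    [t |-> (1 - t) / (1 + t)] act freely on the nonresidue locus of the sextic:
    [t ^+ 2 + t ^- 2] is an invariant of the first two, on whose values the
    third one acts as the involution [z |-> (2 z + 12) / (z - 2)]. *)
Lemma dvdn8_sextic : (8 %| #|[set t | chi (sextic t) == -1%R]|)%N.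
Proof.
have two0 := two_neq0 cardF.
set X := [set t | _].
have XP t : t \in X ->
    [/\ t != 0, t ^+ 2 != 1, t ^+ 2 != -1 & t ^+ 4 - 6 * t ^+ 2 + 1 != 0] /\
    [/\ - t \in X, t^-1 \in X & (1 - t) / (1 + t) \in X].
  by rewrite !inE => /eqP/sextic_invariances[? [-> -> ->]]; rewrite eqxx.
pose w (t : F) := t ^+ 2 + t ^- 2.
have fiber4 t : t \in X -> #|[set s in X | w s == w t]| = 4%N.
  move=> tX; have [[t0 t1 ti _] [NX VX _]] := XP t tX.
  have [_ [NVX _ _]] := XP _ VX.
  have -> : [set s in X | w s == w t] = [set t; - t] :|: [set t^-1; - t^-1].
    apply/setP=> s; rewrite !inE; apply/andP/idP => [[sX /eqP wst]|].
      have /XP[[s0 _ _ _] _] : s \in X by rewrite inE.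
      have : (s ^+ 2 - t ^+ 2) * (s ^+ 2 - t^-1 ^+ 2) = 0.
        have -> : (s ^+ 2 - t ^+ 2) * (s ^+ 2 - t^-1 ^+ 2) = s ^+ 2 * (w s - w t).
          by rewrite /w; field; rewrite s0 t0.
        by rewrite wst subrr mulr0.
      by move/eqP; rewrite mulf_eq0 !subr_eq0 !eqf_sqr.
    move: NX VX NVX tX; rewrite !inE => NX VX NVX tX.
    by case/orP=> /orP[]/eqP->; split=> //; apply/eqP; rewrite /w; field;
      rewrite ?oppr_eq0 ?t0 ?oner_neq0.
  have sep (a : F) : a != 0 -> a != - a.
    by move=> a0; rewrite -subr_eq0 opprK -mulr2n -mulr_natl mulf_neq0.
  have tV (e : F) : t ^+ 2 != e -> e ^+ 2 = 1 -> t != e * t^-1.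
    by move=> te e2; apply: contraNneq te => te; rewrite expr2 {1}te mulfVK.
  rewrite cardsU !cards2 !sep ?invr_eq0 // (_ : _ :&: _ = set0) ?cards0 //.
  apply/setP=> s; rewrite !inE; apply/negP => /andP[st sV].
  have := tV 1 t1 (expr1n _ _); have := tV (-1) ti.
  rewrite mulN1r mul1r sqrrN expr1n => /(_ erefl) nN n1.
  case/orP: st => /eqP st; case/orP: sV => /eqP sV; move: st; rewrite sV => /eqP.
  - by rewrite eq_sym (negPf n1).
  - by rewrite eq_sym (negPf nN).
  - by rewrite eq_sym eqr_oppLR (negPf nN).
  - by rewrite eqr_opp eq_sym (negPf n1).
have -> : #|X| = (#|w @: X| * 4)%N.
  rewrite -sum1_card (partition_big_imset w) /= -sum_nat_const.
  apply: eq_bigr => z /imsetP[t tX ->]; rewrite sum1dep_card -(fiber4 t tX).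
  by apply: eq_card => s; rewrite !inE.
suff : (2 %| #|w @: X|)%N by move=> h; rewrite -[8%N]/(2 * 4)%N dvdn_pmul2r.
pose j (z : F) := if z == 2 then 2 else (2 * z + 12) / (z - 2).
have wX z : z \in w @: X -> exists2 t, t \in X & z = w t by case/imsetP=> t; exists t.
have w2 t : t \in X -> w t - 2 = ((t ^+ 2 - 1) / t) ^+ 2 /\ w t != 2.
  move=> tX; have [[t0 t1 _ _] _] := XP t tX.
  have e : w t - 2 = ((t ^+ 2 - 1) / t) ^+ 2 by rewrite /w; field.
  by split=> //; rewrite -subr_eq0 e expf_neq0 // mulf_neq0 ?invr_eq0 // subr_eq0.
apply: (dvdn2_card_involution (f := j)) => [z|z|z].
- rewrite /j; have [->|z2] := eqVneq z 2; first by rewrite eqxx.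
  have zd : z - 2 != 0 by rewrite subr_eq0.
  have e : (2 * z + 12) / (z - 2) - 2 = 2 ^+ 4 / (z - 2) by field.
  have d0 : (2 * z + 12) / (z - 2) - 2 != 0 by rewrite e mulf_neq0 ?invr_eq0 ?expf_neq0.
  rewrite -subr_eq0 (negPf d0) e; field.
  by rewrite zd (_ : 16 = 2 ^+ 4) ?expf_neq0 // -natrX.
- case/imsetP=> t tX ->; have [[t0 t1 ti _] [_ _ mX]] := XP t tX; have [e w2t] := w2 t tX.
  have u0 : 1 + t != 0.
    by apply: contraNneq t1 => e1; rewrite sqrf_eq1 -[t == -1]addr_eq0 [t + 1]addrC e1 eqxx orbT.
  have v0 : 1 - t != 0.
    by apply: contraNneq t1 => e1; rewrite sqrf_eq1 -[t == 1]subr_eq0 -opprB e1 oppr0 eqxx.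
  apply/imsetP; exists ((1 - t) / (1 + t)) => //.
  rewrite /j (negPf w2t) e /w; field.
  rewrite t0 u0 v0 /=; apply: contraNneq t1 => t1; rewrite -subr_eq0; exact/eqP.
- case/imsetP=> t tX ->; have [[t0 t1 ti tq] _] := XP t tX; have [e w2t] := w2 t tX.
  rewrite /j (negPf w2t) -subr_eq0.
  have w20 : w t - 2 != 0 by rewrite subr_eq0.
  have -> : (2 * w t + 12) / (w t - 2) - w t =
     - ((t ^+ 4 - 6 * t ^+ 2 + 1) * (t ^+ 2 + 1) ^+ 2 / t ^+ 4) / (w t - 2).
    by apply: (mulIf w20); rewrite mulrBl !divfK //; rewrite /w; field.
  by rewrite mulf_neq0 ?invr_eq0 // oppr_eq0 !mulf_neq0 ?invr_eq0 ?expf_neq0 // addr_eq0.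
Qed.

End Symmetry.

Lemma sum_indicator (P : pred F) : \sum_t (P t)%:Z = #|[set t | P t]|%:Z.
Proof.
rewrite -[RHS]natz -sum1dep_card natr_sum [RHS]big_mkcond /=.
by apply: eq_bigr => t _; case: (P t).
Qed.

Lemma sextic_eq0 (t : F) : (sextic t == 0)%:Z =
  (t ^+ 2 == -1)%:Z + ((t - 1) ^+ 2 == 2)%:Z + ((t + 1) ^+ 2 == 2)%:Z.
Proof.
have two0 := two_neq0 cardF.
have -> : (sextic t == 0) = [|| t ^+ 2 == -1, (t - 1) ^+ 2 == 2 | (t + 1) ^+ 2 == 2].
  have -> : sextic t = (t ^+ 2 - -1) * (((t - 1) ^+ 2 - 2) * ((t + 1) ^+ 2 - 2)).
    by rewrite /sextic; ring.
  by rewrite !mulf_eq0 !subr_eq0.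
have [e1|] := eqVneq (t ^+ 2) (-1).
  have -> : (t - 1) ^+ 2 = - (2 * t).
    have -> : (t - 1) ^+ 2 = t ^+ 2 + 1 - 2 * t by ring.
    by rewrite e1 addNr sub0r.
  have -> : (t + 1) ^+ 2 = 2 * t.
    have -> : (t + 1) ^+ 2 = t ^+ 2 + 1 + 2 * t by ring.
    by rewrite e1 addNr add0r.
  have tN a : a ^+ 2 = 1 -> t != a.
    move=> a1; apply: contraNneq two0 => ta; have := e1; rewrite ta a1 => /eqP.
    by rewrite -subr_eq0 opprK.
  have -> : (2 * t == 2) = false.
    by apply/negbTE; rewrite -[X in _ != X]mulr1 (inj_eq (mulfI two0)) tN ?expr1n.
  have -> // : (- (2 * t) == 2) = false.
  apply/negbTE; rewrite -mulrN -[X in _ != X]mulr1 (inj_eq (mulfI two0)).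
  by rewrite eqr_oppLR tN // sqrrN expr1n.
move=> _; have [e1|] := eqVneq ((t - 1) ^+ 2) 2 => //.
have [e2|] := eqVneq ((t + 1) ^+ 2) 2 => //.
have t0 : t = 0.
  apply: (mulfI (mulf_neq0 two0 two0)); rewrite mulr0.
  have -> : 2 * 2 * t = (t + 1) ^+ 2 - (t - 1) ^+ 2 by ring.
  by rewrite e1 e2 subrr.
move: e2; rewrite t0 add0r expr1n => /eqP; rewrite -subr_eq0.
by have -> : 1 - 2 = -1 :> F; [ring|rewrite oppr_eq0 oner_eq0].
Qed.

Lemma sum_sextic_eq0 : \sum_(t : F) (sextic t == 0)%:Z = 3 + chi (-1) + 2 * chi 2.
Proof.
have ind a : \sum_t (t ^+ 2 == a)%:Z = 1 + chi a.
  by rewrite (sum_indicator (fun t => t ^+ 2 == a)) (card_sqrt cardF).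
under eq_bigr do rewrite sextic_eq0; rewrite !big_split /= ind.
have -> : \sum_(t : F) ((t - 1) ^+ 2 == 2)%:Z = 1 + chi 2.
  by rewrite -ind [RHS](reindex_inj (addIr (- 1))).
have -> : \sum_(t : F) ((t + 1) ^+ 2 == 2)%:Z = 1 + chi 2.
  by rewrite -ind [RHS](reindex_inj (addIr 1)).
by ring.
Qed.

(** The terms of the sum are [1], [0] and [-1]: their number is known, so is the
    number of zeros, and the terms [-1] come by eight. *)
Lemma proj_sum1_mod16 : chi (- 2%:R) = 1 ->
  exists m : int, proj_sum 1 = #|F|%:Z - 2 - chi (-1) - 2 * chi 2 - 16 * m.
Proof.
move=> chim2; have /dvdnP[m Xm] := dvdn8_sextic chim2.
exists m%:Z; rewrite proj_sum1E.
have -> : \sum_t chi (sextic t) = \sum_(t : F) (1 - (sextic t == 0)%:Z) -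
    2 * \sum_t (chi (sextic t) == -1)%:Z.
  rewrite mulr_sumr -sumrB; apply: eq_bigr => t _.
  have [->|t0] := eqVneq (sextic t) 0; first by rewrite qchar0.
  by case: (qchar_cases N t0) => ->.
rewrite sumrB sum_sextic_eq0 sumr_const natz (sum_indicator (fun t => chi (sextic t) == -1)) Xm.
by rewrite PoszM; ring.
Qed.

Lemma cubic_sum_eq0 : chi (- 2%:R) = -1 -> cubic_sum = 0.
Proof.
move=> chim2; have [b] := proj_sum_norm.
rewrite chim2 subrr mulr0 proj_sum1_cubic; nia.
Qed.

(** With [p = #|F|], the norm equation is [4 S ^+ 2 + 2 T ^+ 2 = 16 p]; reading it
    modulo powers of 2 shows that [S] is even and that [T] is divisible by 4. *)
Theorem cubic_sum_norm : chi (- 2%:R) = 1 -> exists s e m : int,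
  [/\ cubic_sum = 2 * s, #|F|%:Z = s ^+ 2 + 2 * e ^+ 2
    & 4 * s = #|F|%:Z - 2 - chi (-1) - 2 * chi 2 - 16 * m].
Proof.
move=> chim2; have [b] := proj_sum_norm; have [m] := proj_sum1_mod16 chim2.
rewrite proj_sum1_cubic chim2; set S := cubic_sum; set T := proj_sum _.
move=> Sm TS; have evenM (x y : int) : x ^+ 2 = 2 * y -> exists z, x = 2 * z.
  by move=> xy; exists (x %/ 2)%Z; nia.
have [t Tt] : exists t, T = 2 * t by apply: (evenM _ (4 * #|F|%:Z - S ^+ 2)); lia.
have [s Ss] : exists s, S = 2 * s.
  by apply: (evenM _ (2 * #|F|%:Z - t ^+ 2)); move: TS; rewrite Tt; lia.
have [e te] : exists e, t = 2 * e.
  by apply: (evenM _ (#|F|%:Z - s ^+ 2)); move: TS; rewrite Tt Ss; lia.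
exists s, e, m; split=> //; move: TS Sm; rewrite Tt Ss te; lia.
Qed.

End QuarticSums.

(** * Legendre polynomials over a commutative ring *)

Section HomogeneousLegendre.

Variables (R : comNzRingType) (q : R).

(** At [y * x] and [q = y ^+ 2] this is [n! * y ^+ n * P_n x]. The factor [n!]
    removes the divisions from the usual recurrence, which then makes sense
    modulo [p], and the homogenisation avoids choosing a square root of [q]. *)
Fixpoint hlegendre (n : nat) : {poly R} :=
  match n with
  | 0 => 1
  | m.+1 =>
    match m with
    | 0 => 'X
    | k.+1 => (2 * m + 1)%:R *: ('X * hlegendre m)
              - (m%:R ^+ 2 * q) *: hlegendre k
    end
  end.

Lemma hlegendreS n : hlegendre n.+2 =
  (2 * n%:R + 3) *: ('X * hlegendre n.+1) - ((n%:R + 1) ^+ 2 * q) *: hlegendre n.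
Proof.
rewrite [LHS]/= -/(hlegendre n.+1) -/(hlegendre n); congr (_ *: _ - (_ ^+ 2 * _) *: _).
  by rewrite natrD natrM mulrS; ring.
by rewrite mulrS addrC.
Qed.

(** Two classical contiguity relations, which have to be proved together. *)
Lemma deriv_hlegendre n :
  (hlegendre n.+1)^`() = (n%:R + 1) *: ('X * (hlegendre n)^`() + (n%:R + 1) *: hlegendre n)
  /\ 'X * (hlegendre n.+1)^`() = (n%:R + 1) *: (q *: (hlegendre n)^`() + hlegendre n.+1).
Proof.
elim: n => [|n [IH1 IH2]].
  rewrite /= derivX derivC mulr0 scaler0 !add0r !scale1r !mulr1; by split.
have n1 : n.+1%:R = n%:R + 1 :> R by rewrite mulrS addrC.
set P := (hlegendre n.+1)^`() in IH1 IH2 *.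
have dP : (hlegendre n.+2)^`() = (n%:R + 2) *: ('X * P + (n%:R + 2) *: hlegendre n.+1).
  have -> : (hlegendre n.+2)^`() = (2 * n%:R + 3) *: (hlegendre n.+1 + 'X * P)
     - (n%:R + 1) *: ((n%:R + 1) *: (q *: (hlegendre n)^`() + hlegendre n.+1)
       - (n%:R + 1) *: hlegendre n.+1).
    rewrite hlegendreS derivB !derivZ derivM derivX mul1r -/P.
    by rewrite -!mul_polyC; ring.
  rewrite -IH2 -!mul_polyC; ring.
split; first by rewrite dP n1 -addrA.
rewrite dP n1 hlegendreS -addrA.
have key : 'X * ('X * P) - q *: P =
  (n%:R + 1) *: ('X * hlegendre n.+1 - (q * (n%:R + 1)) *: hlegendre n).
  rewrite IH2 [X in _ - q *: X]IH1.
  by rewrite -!mul_polyC; ring.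
have -> : 'X * ((n%:R + 2) *: ('X * P + (n%:R + 2) *: hlegendre n.+1)) =
  (n%:R + 2) *: (('X * ('X * P) - q *: P) + q *: P + (n%:R + 2) *: ('X * hlegendre n.+1)).
  by rewrite -!mul_polyC; ring.
rewrite key -!mul_polyC; ring.
Qed.

Lemma hlegendre_ode n :
  (('X^2 - q%:P) * (hlegendre n)^`())^`() = (n%:R * (n%:R + 1)) *: hlegendre n.
Proof.
case: n => [|n]; first by rewrite /= derivC mulr0 derivC mul0r scale0r.
have [e1 e2] := deriv_hlegendre n.
have -> : ('X^2 - q%:P) * (hlegendre n.+1)^`() =
   (n%:R + 1) *: ('X * hlegendre n.+1 - (q * (n%:R + 1)) *: hlegendre n).
  have -> : ('X^2 - q%:P) * (hlegendre n.+1)^`() =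
    'X * ('X * (hlegendre n.+1)^`()) - q%:P * (hlegendre n.+1)^`() by ring.
  rewrite e2 e1 -!mul_polyC; ring.
rewrite derivZ derivB derivM !derivZ derivX mul1r e2 mulrS.
rewrite -!mul_polyC; ring.
Qed.

Lemma coef_hlegendre n j :
  (j%:R * (j%:R + 1) - n%:R * (n%:R + 1)) * (hlegendre n)`_j
  = q * (j%:R + 1) * (j%:R + 2) * (hlegendre n)`_j.+2.
Proof.
have coefd (P : {poly R}) i : P^`()`_i = P`_i.+1 * (i%:R + 1).
  by rewrite coef_deriv natr1 mulr_natr.
have := congr1 (fun P : {poly R} => P`_j) (hlegendre_ode n).
rewrite coefd coefZ mulrBl coefB coefCM coefXnM !coefd.
case: j => [|j] /= e; first by rewrite mulrBl -e mulrS; ring.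
by rewrite mulrBl -e !subSS subn0 !mulrS; ring.
Qed.

Lemma size_hlegendre n : (size (hlegendre n) <= n.+1)%N.
Proof.
suff [] : (size (hlegendre n) <= n.+1)%N /\ (size (hlegendre n.+1) <= n.+2)%N by [].
elim: n => [|n [IH1 IH2]]; first by rewrite /= size_poly1 size_polyX.
split=> //; rewrite hlegendreS (leq_trans (size_polyD _ _)) // geq_max size_polyN.
apply/andP; split; apply: leq_trans (size_scale_leq _ _) _.
  by apply: leq_trans (size_polyMleq _ _) _; rewrite size_polyX.
by apply: leq_trans IH1 _; lia.
Qed.

Lemma lead_hlegendre n : (hlegendre n)`_n = \prod_(i < n) (2 * i + 1)%:R.
Proof.
elim: n => [|n IHn]; first by rewrite big_ord0 coef1.
rewrite big_ord_recr -IHn /=; case: n {IHn} => [|n]; first by rewrite coefX coef1 mul1r.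
rewrite -/(hlegendre n.+2) hlegendreS coefB !coefZ coefXM /=.
rewrite [(hlegendre n)`__]nth_default ?mulr0 ?subr0; last exact: leq_trans (size_hlegendre n) _.
by rewrite mulrC natrD natrM mulrS; ring.
Qed.

End HomogeneousLegendre.

Lemma hlegendre_square (R : comNzRingType) (x : R) n :
  (hlegendre (x ^+ 2) n).[x] = x ^+ n * (n`!)%:R.
Proof.
suff [] : (hlegendre (x ^+ 2) n).[x] = x ^+ n * (n`!)%:R /\
  (hlegendre (x ^+ 2) n.+1).[x] = x ^+ n.+1 * (n.+1`!)%:R by [].
elim: n => [|n [IH1 IH2]]; first by rewrite /= hornerC hornerX !mulr1.
split=> //; rewrite hlegendreS hornerD hornerN !hornerZ !hornerM !hornerX IH1 IH2.
rewrite !factS !natrM !exprS !mulrS; ring.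
Qed.

Lemma hlegendreN (R : comNzRingType) (q x : R) n :
  (hlegendre q n).[- x] = (-1) ^+ n * (hlegendre q n).[x].
Proof.
suff [] : (hlegendre q n).[- x] = (-1) ^+ n * (hlegendre q n).[x] /\
  (hlegendre q n.+1).[- x] = (-1) ^+ n.+1 * (hlegendre q n.+1).[x] by [].
elim: n => [|n [IH1 IH2]]; first by rewrite /= !hornerC !hornerX !expr0 mul1r mulN1r.
split=> //; rewrite hlegendreS !hornerD !hornerN !hornerZ !hornerM !hornerX IH1 IH2 !exprS; ring.
Qed.

(** * The cubic power sum as a Legendre polynomial *)

(** Both sides are equal to
    [N! / (j! (N - h)! (3 h - N - 3)!)], read as [0] if [3 h < N + 3]. *)
Lemma binomial_shift N j h : (j + 2 * h = N)%N -> (0 < h)%N -> (N <= 3 * h)%N ->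
  ((j + 1) * (j + 2) * (N - h + 1) * ('C(N, j + 2) * 'C(2 * h - 2, N - h + 1)) =
  (3 * h - N) * (3 * h - N - 1) * (3 * h - N - 2) * ('C(N, j) * 'C(2 * h, N - h)))%N.
Proof.
move=> jh h0 Nh.
have [b3|b3] := ltnP (3 * h - N) 3.
  rewrite [in LHS](bin_small (m := N - h + 1)) ?muln0; last by lia.
  have : (3 * h - N = 0 \/ 3 * h - N = 1 \/ 3 * h - N = 2)%N by lia.
  by case=> [->|[->|->]].
have fpos m : (0 < m`!)%N by exact: fact_gt0.
have e1 := @bin_fact N (j + 2) ltac:(lia).
have e2 := @bin_fact (2 * h - 2) (N - h + 1) ltac:(lia).
have e3 := @bin_fact N j ltac:(lia).
have e4 := @bin_fact (2 * h) (N - h) ltac:(lia).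
have f1 : ((j + 2)`! = (j + 2) * ((j + 1) * j`!))%N by rewrite addn2 addn1 !factS.
have f2 : ((N - h + 1)`! = (N - h + 1) * (N - h)`!)%N by rewrite addn1 factS.
have b3E : (2 * h - (N - h) = (2 * h - 2 - (N - h + 1)).+3)%N by lia.
have f3 : ((2 * h - (N - h))`! = (3 * h - N) * ((3 * h - N - 1) * ((3 * h - N - 2) *
   (2 * h - 2 - (N - h + 1))`!)))%N.
  rewrite b3E !factS; congr (_ * (_ * (_ * _)))%N; lia.
have g1 : (N - (j + 2) = 2 * h - 2)%N by lia.
have g2 : (N - j = 2 * h)%N by lia.
rewrite g1 f1 in e1; rewrite f2 in e2; rewrite g2 in e3; rewrite f3 in e4.
set m1 := ('C(N, j + 2))%N in e1 *; set m2 := 'C(2 * h - 2, _) in e2 *.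
set m3 := ('C(N, j))%N in e3 *; set m4 := 'C(2 * h, _) in e4 *.
set w := (_ - (_ + 1))`! in e2 e4; have w0 : (0 < w)%N by apply: fpos.
have p1 := fpos j; have p2 := fpos (N - h)%N; have p3 := fpos (2 * h)%N.
have p4 := fpos (2 * h - 2)%N.
apply/eqP; rewrite -(eqn_pmul2r (m := j`! * (N - h)`! * w)) ?muln_gt0 ?p1 ?p2 //.
apply/eqP.
transitivity (N`!).
  rewrite -e1 -e2; ring.
rewrite -e3 -e4; ring.
Qed.

Section Proportional.

Variables (F : fieldType) (n : nat) (q : F).
Hypothesis charF : forall j, (0 < j <= 2 * n)%N -> j%:R != 0 :> F.

Definition legendre_recurrence (c : nat -> F) :=
  (forall j, (n < j)%N -> c j = 0) /\
  forall j, (j%:R * (j%:R + 1) - n%:R * (n%:R + 1)) * c j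
            = q * (j%:R + 1) * (j%:R + 2) * c j.+2.

(** The recurrence determines every coefficient from the top one, its left
    factor [(j - n) (j + n + 1)] being invertible for [j < n]. *)
Lemma legendre_recurrence_proportional c d :
  legendre_recurrence c -> legendre_recurrence d -> forall j, c n * d j = d n * c j.
Proof.
move=> [c0 cr] [d0 dr] j.
have [m] := ubnP (n - j); elim: m j => // m IHm j ltm.
have [jn|jn|->] := ltngtP j n; last by rewrite mulrC.
- have a0 : j%:R * (j%:R + 1) - n%:R * (n%:R + 1) != 0 :> F.
    have -> : j%:R * (j%:R + 1) - n%:R * (n%:R + 1) = - ((n - j)%:R * (n + j + 1)%:R) :> F.
      by rewrite natrB ?(ltnW jn) // !natrD; ring.
    by rewrite oppr_eq0 mulf_neq0 // charF //; lia.
  apply: (mulfI a0); rewrite mulrCA dr [RHS]mulrCA cr.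
  transitivity (q * (j%:R + 1) * (j%:R + 2) * (c n * d j.+2)); first by ring.
  by rewrite IHm; [ring|lia].
- by rewrite (c0 j) // (d0 j) // !mulr0.
Qed.

End Proportional.

Section CubicPowerSums.

Variables (F : finFieldType) (N : nat).
Hypothesis cardF : #|F| = N.*2.+1.
Hypothesis charF : forall j, (0 < j < #|F|)%N -> j%:R != 0 :> F.

Lemma two_half_card : 2 * N%:R + 1 = 0 :> F.
Proof. by rewrite -natrM natr1 mul2n -cardF mulrn_card. Qed.

(** When [F] is a prime field, this is the opposite of the Hasse invariant of
    [Y ^+ 2 = X ^+ 3 - 3 * m * X + 2 * x]. *)
Definition cubic_power_sum (m x : F) : F := \sum_X (X ^+ 3 - 3 * m * X + 2 * x) ^+ N.

Definition cubic_power_coef (m : F) (j : nat) : F :=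
  'C(N, j)%:R * 2 ^+ j * \sum_X (X ^+ 3 - 3 * m * X) ^+ (N - j).

Lemma cubic_power_sumE m x : cubic_power_sum m x = \sum_(j < N.+1) cubic_power_coef m j * x ^+ j.
Proof.
rewrite /cubic_power_sum; under eq_bigr do rewrite exprDn; rewrite exchange_big /=.
apply: eq_bigr => j _; rewrite /cubic_power_coef mulr_sumr mulr_suml.
by apply: eq_bigr => X _; rewrite exprMn -mulr_natr; ring.
Qed.

(** The exponents of [X] in the expansion run from [M] to [3 * M], which is less
    than [4 * N]; so only [X ^+ N.*2] has a nonzero sum. *)
Lemma sum_cubic_power m M : (M <= N)%N ->
  \sum_X (X ^+ 3 - 3 * m * X) ^+ M =
  if odd M || (3 * (M./2) < N)%N then 0
  else - ('C(M, N - M./2)%:R * (- (3 * m)) ^+ (3 * (M./2) - N)) :> F.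
Proof.
move=> MN; have N0 := half_card_gt0 cardF.
have -> : \sum_X (X ^+ 3 - 3 * m * X) ^+ M =
   \sum_(i < M.+1) 'C(M, i)%:R * (- (3 * m)) ^+ (M - i) * \sum_(X : F) X ^+ (M + 2 * i).
  transitivity (\sum_(X : F) \sum_(i < M.+1)
     'C(M, i)%:R * (- (3 * m)) ^+ (M - i) * X ^+ (M + 2 * i)).
    apply: eq_bigr => X _.
    have -> : X ^+ 3 - 3 * m * X = X * (- (3 * m) + X ^+ 2) by ring.
    rewrite exprMn exprDn mulr_sumr; apply: eq_bigr => i _.
    by rewrite -mulr_natr exprD exprM; ring.
  by rewrite exchange_big /=; apply: eq_bigr => i _; rewrite mulr_sumr.
have pw i : (i < M.+1)%N -> \sum_(X : F) X ^+ (M + 2 * i) =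
    if (M + 2 * i == N.*2)%N then -1 else 0.
  move=> iM; rewrite (sum_power cardF); congr (if _ then _ else _).
  apply/andP/eqP => [[k0 /dvdnP[k kE]]|->]; last by rewrite dvdnn double_gt0.
  have : (0 < k < 2)%N by nia.
  by case: k kE => [|[|k]] // kE _; rewrite kE mul1n.
case: ifPn => [bad|].
  rewrite big1 // => i _; rewrite pw // ifN ?mulr0 //.
  apply/eqP => e; case/orP: bad; have := ltn_ord i; last by lia.
  by have := odd_double_half M; lia.
rewrite negb_or -leqNgt => /andP[Meven MN3].
have MhE : (M = 2 * M./2)%N by have := odd_double_half M; rewrite (negPf Meven); lia.
have iM : (N - M./2 < M.+1)%N by lia.
rewrite (bigD1 (Ordinal iM)) //= pw // ifT; last by apply/eqP; lia.
rewrite big1 ?addr0 => [|i]; first by rewrite mulrN1; congr (- (_ * _ ^+ _)); lia.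
rewrite -val_eqE /= => /eqP iN; rewrite pw // ifN ?mulr0 //; apply/eqP; lia.
Qed.

(* The two cases are [#|F| = 6 n + 1], with [h = n] and [b = 0], and
   [#|F| = 6 n + 5], with [h = n + 1] and [b = 1]. *)
Variables n h b : nat.
Hypotheses (N_nh : N = (n + 2 * h)%N) (h_Nb : (3 * h = N + b)%N).
Hypotheses (n_gt0 : (0 < n)%N) (b_lt3 : (b < 3)%N).
Hypothesis n_mod : 36 * (n%:R * (n%:R + 1)) + 5 = 0 :> F.

Lemma cubic_power_coef_top m :
  cubic_power_coef m n =
  - ('C(N, n)%:R * 2 ^+ n * 'C(2 * h, N - h)%:R * (-3) ^+ b) * m ^+ b.
Proof.
have Nn : (N - n = h.*2)%N by lia.
rewrite /cubic_power_coef sum_cubic_power Nn; last by lia.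
rewrite odd_double doubleK /= ifN; last by lia.
have -> : (3 * h - N = b)%N by lia.
by rewrite -(mulNr 3 m) exprMn mul2n; ring.
Qed.

(** The ratio of the coefficients of [x ^+ j] and [x ^+ j.+2] is a rational
    function of [j] and [N]; substituting [N = - 1 / 2], which is true in [F],
    turns it into the one of the Legendre equation, [n * (n + 1)] being
    [- 5 / 36]. *)
Lemma cubic_power_coef_recurrence m : legendre_recurrence n (m ^+ 3) (cubic_power_coef m).
Proof.
have N0 := half_card_gt0 cardF.
have zero j : (n < j)%N -> cubic_power_coef m j = 0.
  move=> nj; rewrite /cubic_power_coef; have [jN|jN] := leqP j N; last by rewrite bin_small ?mul0r.
  rewrite sum_cubic_power ?leq_subr // ifT ?mulr0 //.
  have := odd_double_half (N - j); case: (odd _) => //=; lia.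
split=> // j; have [nj|jn] := ltnP n j; first by rewrite !zero ?mulr0 //; lia.
have jN : (j + 2 <= N)%N by lia.
have [oddNj|evenNj] := boolP (odd (N - j)).
  have oddNj2 : odd (N - j.+2) by lia.
  by rewrite /cubic_power_coef !sum_cubic_power ?leq_subr // oddNj oddNj2 !mulr0.
have [nj|nj] := eqVneq j n; first by rewrite nj subrr mul0r zero ?mulr0 //; lia.
have [k kE] : exists k, (j + 2 * k = N)%N by exists (N - j)./2; lia.
have [c cE] : exists c, (3 * k = N + c.+3)%N by exists (3 * k - N - 3)%N; lia.
have closed i l d : (i + 2 * l = N)%N -> (3 * l = N + d)%N ->
   cubic_power_coef m i = - (('C(N, i) * 'C(2 * l, N - l))%:R * 2 ^+ i * (- (3 * m)) ^+ d).
  move=> iE dE; rewrite /cubic_power_coef sum_cubic_power ?leq_subr //.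
  have -> : (N - i = l.*2)%N by lia.
  rewrite odd_double doubleK ifN /=; last by lia.
  by rewrite -mul2n (_ : 3 * l - N = d)%N; [rewrite natrM; ring|lia].
rewrite (closed j k c.+3) // (closed j.+2 k.-1 c); [|lia|lia].
have := @binomial_shift N j k kE ltac:(lia) ltac:(lia).
have -> : (2 * k - 2 = 2 * k.-1)%N by lia.
have -> : (N - k + 1 = N - k.-1)%N by lia.
rewrite addn2 addn1 -addn2.
set A := ('C(N, j) * _)%N; set B := ('C(N, j + 2) * _)%N => /(congr1 (fun i => i%:R : F)).
rewrite (_ : 3 * k - N = c + 3)%N; last by lia.
rewrite (_ : c + 3 - 1 = c + 2)%N; last by lia.
rewrite (_ : c + 3 - 2 = c + 1)%N; last by lia.
rewrite addn2 !natrM -natr1.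
have jk : 2 * (j%:R + 2 * k%:R) + 1 = 0 :> F.
  by rewrite -two_half_card -kE natrD natrM.
have cR : c%:R = k%:R - j%:R - 3 :> F.
  by apply/eqP; rewrite eq_sym !subr_eq -!natrD; apply/eqP; congr (_%:R); lia.
have dR : (N - k.-1)%:R = j%:R + k%:R + 1 :> F.
  by rewrite -natrD natr1; congr (_%:R); lia.
have d0 : j%:R + k%:R + 1 != 0 :> F by rewrite -dR charF // cardF; lia.
rewrite dR ![(c + _)%:R]natrD cR -[j.+2%:R]natr1 -natr1.
set a := 'C(N, j)%:R * _; set b' := 'C(N, j + 2)%:R * _ => shift.
have two0 := two_neq0 cardF; have three0 : 3 != 0 :> F by apply: charF; rewrite cardF; lia.
have nn : n%:R * (n%:R + 1) = - (5 / 36) :> F.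
  have -> : n%:R * (n%:R + 1) = (36 * (n%:R * (n%:R + 1)) + 5) / 36 - 5 / 36 :> F.
    by field; rewrite (_ : 36 = 2 ^+ 2 * 3 ^+ 2) ?mulf_neq0 ?expf_neq0 // -!natrX -natrM.
  by rewrite n_mod mul0r sub0r.
have jR : j%:R = - 2^-1 - 2 * k%:R :> F.
  apply: (mulfI two0); apply/eqP; rewrite -subr_eq0.
  have -> : 2 * j%:R - 2 * (- 2^-1 - 2 * k%:R) = 2 * (j%:R + 2 * k%:R) + 1 :> F by field.
  by rewrite jk.
apply: (mulfI d0); rewrite [(- (3 * m)) ^+ c.+3]exprS !exprS.
transitivity (- m ^+ 3 * 2 ^+ j * (- (3 * m)) ^+ c * 4 *
   ((j%:R + 1) * (j%:R + 2) * (j%:R + k%:R + 1) * b')); last by ring.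
transitivity (- m ^+ 3 * 2 ^+ j * (- (3 * m)) ^+ c * 4 *
   ((j%:R + 1) * (j%:R + 1 + 1) * (j%:R + k%:R + 1) * b')); last by ring.
rewrite shift nn jR; field.
by rewrite two0 (_ : 36 = 2 ^+ 2 * 3 ^+ 2) ?mulf_neq0 ?expf_neq0 // -!natrX -natrM.
Qed.

Lemma cubic_power_sum11 : cubic_power_sum 1 1 = - 3 ^+ N.
Proof.
have N0 := half_card_gt0 cardF.
have three0 : 3 != 0 :> F by apply: charF; rewrite cardF; lia.
have sum0 : \sum_(X : F) X ^+ N = 0.
  by rewrite (sum_power cardF) gtnNdvd ?andbF //; lia.
rewrite -[RHS]add0r -[in RHS]sum0 (reindex_inj (addIr 2)) [in RHS](bigD1 1) //=.
have -> : 1 + 2 = 3 :> F by ring.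
rewrite addrAC subrr add0r /cubic_power_sum (bigD1 1) //=.
have -> : 1 ^+ 3 - 3 * 1 * 1 + 2 * 1 = 0 :> F by ring.
rewrite expr0n gtn_eqF // add0r; apply: eq_bigr => X X1.
have -> : X ^+ 3 - 3 * 1 * X + 2 * 1 = (X - 1) ^+ 2 * (X + 2) by ring.
by rewrite exprMn -exprM mul2n (expf_double_half cardF) ?mul1r ?subr_eq0.
Qed.

(** The constant of proportionality is found at [m = x = 1], where the cubic
    [X ^+ 3 - 3 * X + 2 = (X - 1) ^+ 2 * (X + 2)] degenerates. *)
Theorem cubic_power_sum_hlegendre m x :
  (n`!)%:R * cubic_power_sum m x = - (3 ^+ N * m ^+ b * (hlegendre (m ^+ 3) n).[x]).
Proof.
have charn j : (0 < j <= 2 * n)%N -> j%:R != 0 :> F.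
  by move=> j_le; apply: charF; rewrite cardF; lia.
have prop c y : (hlegendre (c ^+ 3) n)`_n * cubic_power_sum c y =
    cubic_power_coef c n * (hlegendre (c ^+ 3) n).[y].
  rewrite cubic_power_sumE (@horner_coef_wide _ N.+1); last first.
    by apply: leq_trans (size_hlegendre _ _) _; lia.
  rewrite !mulr_sumr; apply: eq_bigr => j _; rewrite [LHS]mulrA [RHS]mulrA; congr (_ * _).
  apply: (legendre_recurrence_proportional charn (q := c ^+ 3)
    (c := fun i => (hlegendre (c ^+ 3) n)`_i)) (cubic_power_coef_recurrence c) _.
  split=> [i ni|i]; last exact: coef_hlegendre.
  by rewrite nth_default //; apply: leq_trans (size_hlegendre _ _) _.
have lead0 (c : F) : (hlegendre c n)`_n != 0.
  rewrite lead_hlegendre prodf_seq_neq0; apply/allP => i _ /=; apply: charn.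
  by have := ltn_ord i; lia.
have leadE (c : F) : (hlegendre c n)`_n = (hlegendre 1 n)`_n by rewrite !lead_hlegendre.
have top : cubic_power_coef m n = m ^+ b * cubic_power_coef 1 n.
  by rewrite !cubic_power_coef_top expr1n; ring.
have := prop 1 1; rewrite cubic_power_sum11 expr1n -[X in hlegendre X](expr1n _ 2) => prop11.
have h11 : (hlegendre (1 ^+ 2) n).[1] = (n`!)%:R :> F by rewrite hlegendre_square expr1n mul1r.
rewrite h11 expr1n in prop11.
apply: (mulfI (lead0 (m ^+ 3))); rewrite mulrCA prop top leadE.
transitivity (m ^+ b * (hlegendre (m ^+ 3) n).[x] * (cubic_power_coef 1 n * (n`!)%:R)).
  by ring.
by rewrite -prop11; ring.
Qed.

(** If [y = (2 * Z + 5) / 3] then [27 * (y + 1) * (y ^+ 2 - 6 * y + 1)] is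
    [8 * (Z ^+ 3 - 30 * Z - 56)], that is the cubic of [cubic_power_sum] at
    [m = 10] and [x = - 28]. *)
Theorem cubic_sum_hlegendre :
  (n`!)%:R * (cubic_sum F N)%:~R
  = - (2 ^+ N * 10 ^+ b * (-1) ^+ n * (hlegendre 1000 n).[28]) :> F.
Proof.
have two0 := two_neq0 cardF; have three0 : 3 != 0 :> F by apply: charF; rewrite cardF; lia.
have sq a : a != 0 :> F -> a ^+ N * a ^+ N = 1.
  by move=> a0; rewrite -exprD addnn (expf_double_half cardF).
have -> : (cubic_sum F N)%:~R = 6 ^+ N * cubic_power_sum 10 (- 28%:R) :> F.
  rewrite /cubic_sum (big_morph (fun z : int => z%:~R : F) (intrD _) (erefl _)).
  rewrite (reindex_inj (mulfI (mulf_neq0 two0 (invr_neq0 three0)))).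
  rewrite (reindex_inj (addIr (5 / 2))) /= /cubic_power_sum mulr_sumr; apply: eq_bigr => Z _.
  rewrite (qchar_euler cardF) -exprMn.
  have -> : (2 / 3 * (Z + 5 / 2) + 1) * ((2 / 3 * (Z + 5 / 2)) ^+ 2 - 6 * (2 / 3 * (Z + 5 / 2)) + 1)
     = 6 * (Z ^+ 3 - 3 * 10 * Z + 2 * - 28%:R) * (2 / 9) ^+ 2 :> F.
    by field; rewrite two0 (_ : 9 = 3 ^+ 2) ?expf_neq0 ?three0 // -natrX.
  rewrite [LHS]exprMn -exprM mul2n (expf_double_half cardF) ?mulr1 //.
  by rewrite mulf_neq0 ?invr_eq0 // (_ : 9 = 3 ^+ 2) ?expf_neq0 // -natrX.
rewrite mulrCA cubic_power_sum_hlegendre hlegendreN.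
have -> : 10 ^+ 3 = 1000 :> F by rewrite -natrX.
have -> : 6 ^+ N = 2 ^+ N * 3 ^+ N :> F by rewrite -exprMn -natrM.
transitivity (- (2 ^+ N * (3 ^+ N * 3 ^+ N) * 10 ^+ b * (-1) ^+ n * (hlegendre 1000 n).[28]) : F).
  by ring.
by rewrite sq // mulr1.
Qed.

End CubicPowerSums.

(** * Quadratic reciprocity *)

Definition legendre (p : nat) (x : 'F_p) : int := @qchar 'F_p p./2 x.

Section Supplements.

Variable p : nat.
Hypotheses (p_prime : prime p) (p_odd : odd p).
Local Notation chi := (@legendre p).

Lemma card_Fp_half : #|'F_p| = p./2.*2.+1.
Proof. by rewrite card_Fp // -[LHS]odd_double_half p_odd. Qed.

Lemma legendreM x y : chi (x * y) = chi x * chi y.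
Proof. exact/qcharM/card_Fp_half. Qed.

Lemma legendre_inj (e : int) x : e = 1 \/ e = -1 -> x ^+ p./2 = e%:~R -> chi x = e.
Proof. exact/qchar_inj/card_Fp_half. Qed.

Lemma legendre_euler x : (chi x)%:~R = x ^+ p./2 :> 'F_p.
Proof. exact/qchar_euler/card_Fp_half. Qed.

Lemma Fp_nat_eq0 m : (m%:R == 0 :> 'F_p) = (p %| m)%N.
Proof. by rewrite (dvdn_pcharf (pchar_Fp p_prime)). Qed.

Lemma legendre_minus1 : chi (-1) = if (p %% 4 == 1)%N then 1 else -1.
Proof.
apply: legendre_inj; first by case: ifP; [left|right].
rewrite -signr_odd; case: ifPn => p4.
  by rewrite (_ : odd p./2 = false) //; lia.
by rewrite (_ : odd p./2 = true) ?expr1 //; lia.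
Qed.

(** The element [1 + i] has square [2 i], so that [(1 + i) ^+ p], which equals
    [1 + i ^+ p] by Frobenius, is [2 ^+ N * i ^+ N * (1 + i)]. *)
Lemma legendre_two :
  chi 2 = if (p %% 8 == 1)%N || (p %% 8 == 7)%N then 1 else -1.
Proof.
apply: legendre_inj; first by case: ifP; [left|right].
pose K := gaussian 'F_p; pose i : K := (0, 1).
have realn m : m%:R = greal m%:R :> K.
  elim: m => [//|m IHm]; rewrite -natr1 -[in RHS]natr1 IHm.
  by rewrite gaddE /greal /= addr0.
have pK : p \in [pchar K].
  by apply/andP; split=> //; rewrite realn pchar_Fp_0.
have i2 : i ^+ 2 = greal (-1) by rewrite expr2 gmulE /greal /=; congr pair => /=; ring.
have sq : (1 + i) ^+ 2 = greal 2 * i.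
  by rewrite expr2 !gmulE gaddE /greal /=; congr pair => /=; ring.
have realX x m : greal x ^+ m = greal (x ^+ m) :> K.
  by elim: m => // m IHm; rewrite !exprS IHm grealM.
have := pFrobenius_autD_comm pK (commr_sym (commr1 i)).
rewrite !pFrobenius_autE expr1n.
have powp (x : K) : x ^+ p = x * (x ^+ 2) ^+ p./2.
  by rewrite -exprM -exprS; congr (x ^+ _); lia.
have -> : i ^+ p = greal ((-1) ^+ p./2) * i by rewrite powp i2 realX mulrC.
rewrite powp sq exprMn realX.
have -> : i ^+ p./2 = greal ((-1) ^+ (p./2)./2) * i ^+ (odd p./2).
  by rewrite -realX -i2 -exprM -exprD mul2n addnC odd_double_half.
set t := 2 ^+ p./2; move=> /(congr1 fst).
rewrite mulrC -!mulrA re_mul_real re_mul_real -signr_odd -[(-1) ^+ p./2]signr_odd.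
have -> : (1 + greal ((-1) ^+ odd p./2) * i).1 = 1.
  by rewrite gaddE gmulE /greal /=; ring.
have -> : (i ^+ odd p./2 * (1 + i)).1 = (-1) ^+ odd p./2.
  by case: (odd _); rewrite ?expr1 ?expr0 gmulE gaddE /=; ring.
move=> e; have -> : t = (-1) ^+ odd p./2./2 * (-1) ^+ odd p./2.
  set w := (-1) ^+ _ * _ in e *; have w2 : w ^+ 2 = 1 by rewrite exprMn !sqrr_sign mulr1.
  by rewrite -[LHS]mulr1 -w2 expr2 mulrA e mul1r.
rewrite -signr_addb; case: ifPn => p8.
  by rewrite (_ : _ (+) _ = false) //; lia.
by rewrite (_ : _ (+) _ = true) ?expr1 //; lia.
Qed.

End Supplements.

Section GaussSum.

Variables p l : nat.
Hypotheses (p_prime : prime p) (p_odd : odd p).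
Hypotheses (l_prime : prime l) (l_odd : odd l) (p_neq_l : p != l).

(** By Fermat, [p] divides the order of the multiplicative group of a field
    with [l ^ p.-1] elements. *)
Lemma root_of_unity_in_char : exists (L : finFieldType) (z : L),
  l \in [pchar L] /\ forall j, (z ^+ j == 1) = (p %| j)%N.
Proof.
have p_gt2 := odd_prime_gt2 p_odd p_prime.
have k_gt0 : (0 < p.-1)%N by lia.
have [L lL cardL] := PrimePowerField l_prime k_gt0.
have lk1 : (1 < l ^ p.-1)%N by rewrite -{1}(exp1n p.-1) ltn_exp2r // prime_gt1.
have cardL2 : #|L| = (l ^ p.-1)./2.*2.+1.
  by rewrite cardL -[LHS]odd_double_half oddX l_odd orbT.
have [g [g0 _ ordg]] := finfield_generator cardL2.
set M := ((l ^ p.-1)./2.*2)%N in ordg.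
have pM : (p %| M)%N.
  have -> : M = (l ^ p.-1 - 1)%N by rewrite -cardL cardL2 subn1.
  rewrite -eqn_mod_dvd ?(ltnW lk1) // -totient_prime //; apply/eqP/Euler_exp_totient.
  by rewrite coprime_sym prime_coprime // dvdn_prime2.
have M0 : (0 < M)%N by rewrite /M; lia.
exists L, (g ^+ (M %/ p)); split=> // j.
rewrite -exprM ordg -{1}(divnK pM) dvdn_pmul2l //.
by rewrite divn_gt0 ?prime_gt0 // dvdn_leq.
Qed.

(** The Gauss sum [tau] over [F_p], taken in characteristic [l], satisfies
    [tau ^+ 2 = legendre (-1) * p] and, by Frobenius,
    [tau ^+ l = legendre l * tau]. *)
Theorem quadratic_reciprocity :
  legendre (p := l) ((legendre (p := p) (-1) * p%:Z)%:~R) = legendre (p := p) l%:R.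
Proof.
have [L [z [lL ordz]]] := root_of_unity_in_char.
have cardF := card_Fp_half p_prime p_odd.
have zp : z ^+ p = 1 by apply/eqP; rewrite ordz.
pose chi (a : 'F_p) : L := (legendre a)%:~R.
have chiM a b : chi (a * b) = chi a * chi b by rewrite /chi legendreM // rmorphM.
pose psi (a : 'F_p) : L := z ^+ a.
have psi_nat m : psi m%:R = z ^+ m by rewrite /psi val_Fp_nat // expr_mod.
have psiD a b : psi (a + b) = psi a * psi b.
  by rewrite -(natr_Zp a) -(natr_Zp b) -natrD !psi_nat exprD.
have psiX a m : psi a ^+ m = psi (m%:R * a).
  by rewrite -(natr_Zp a) -natrM !psi_nat -exprM mulnC.
have psi0 : psi 0 = 1 by [].
have psi1 a : (psi a == 1) = (a == 0).
  by rewrite /psi ordz -Fp_nat_eq0 // natr_Zp.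
have sum_psi c : c != 0 -> \sum_a psi (a * c) = 0.
  move=> c0; have : psi c * \sum_a psi (a * c) = \sum_a psi (a * c).
    rewrite mulr_sumr [RHS](reindex_inj (addIr 1)); apply: eq_bigr => a _.
    by rewrite -psiD mulrDl mul1r addrC.
  move/eqP; rewrite -subr_eq0 -[X in _ - X]mul1r -mulrBl mulf_eq0 subr_eq0 psi1 (negPf c0).
  by move/eqP.
have pL0 : p%:R != 0 :> L.
  by rewrite -(dvdn_pcharf lL) dvdn_prime2 // eq_sym.
have sum_chi : \sum_a chi a = 0.
  have : (\sum_(a : 'F_p) legendre a)%:~R = 0 :> L by rewrite (sum_qchar cardF).
  by rewrite (big_morph (fun z : int => z%:~R : L) (intrD _) (erefl _)).
pose tau := \sum_a chi a * psi a.
have tau2 : tau ^+ 2 = chi (-1) * p%:R.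
  have -> : tau ^+ 2 = \sum_c \sum_a chi c * (chi a ^+ 2 * psi (a * (1 + c))).
    rewrite expr2 /tau mulr_suml exchange_big /=; apply: eq_bigr => a _.
    rewrite mulr_sumr; have [->|a0] := eqVneq a 0.
      have chi0 : chi 0 = 0 by rewrite /chi /legendre qchar0.
      by rewrite !big1 // => b _; rewrite chi0 ?expr2 !(mul0r, mulr0).
    rewrite (reindex_inj (mulfI a0)); apply: eq_bigr => c _.
    by rewrite chiM mulrDr mulr1 psiD; ring.
  have chi2 a : a != 0 -> chi a ^+ 2 = 1.
    by move=> a0; rewrite /chi -rmorphXn qchar_sq.
  have inner c : \sum_a chi c * (chi a ^+ 2 * psi (a * (1 + c))) =
      chi c * ((if c == -1 then p%:R else 0) - 1).
    rewrite -mulr_sumr; congr (_ * _).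
    have -> : (if c == -1 then p%:R else 0) = \sum_a psi (a * (1 + c)).
      rewrite -[c == -1]addr_eq0 addrC; case: eqVneq => [->|c1]; last by rewrite sum_psi.
      rewrite (eq_bigr (fun=> 1)) => [|a _]; last by rewrite mulr0.
      by rewrite sumr_const card_Fp.
    rewrite (bigD1 0) //= [in RHS](bigD1 0) //= mul0r psi0 addrAC subrr add0r.
    rewrite /chi /legendre qchar0 expr0n mul0r add0r; apply: eq_bigr => a a0.
    by rewrite -/(legendre a) -/(chi a) chi2 // mul1r.
  under eq_bigr do rewrite inner mulrBr mulr1; rewrite sumrB sum_chi subr0.
  rewrite (bigD1 (-1)) //= eqxx big1 ?addr0 // => c c1.
  by rewrite (negPf c1) mulr0.
have taul : tau ^+ l = chi l%:R * tau.
  rewrite -(pFrobenius_autE lL) rmorph_sum mulr_sumr /=.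
  have l0 : l%:R != 0 :> 'F_p by rewrite Fp_nat_eq0 // dvdn_prime2.
  rewrite [RHS](eq_bigr (fun a => chi (l%:R * a) * psi a)) => [|a _]; last by rewrite chiM mulrA.
  rewrite [RHS](reindex_inj (mulfI l0)); apply: eq_bigr => a _.
  have chil : chi l%:R ^+ 2 = 1 by rewrite /chi -rmorphXn qchar_sq.
  rewrite rmorphM /= rmorph_int [X in _ * X = _]pFrobenius_autE psiX !chiM.
  by rewrite [X in _ = X * _]mulrA -expr2 chil mul1r.
have tau0 : tau != 0.
  rewrite -sqrf_eq0 tau2 mulf_neq0 // /chi.
  have m1 : -1 != 0 :> 'F_p by rewrite oppr_eq0 oner_eq0.
  by case: (qchar_cases p./2 m1) => e; rewrite /legendre e ?rmorphN ?oppr_eq0 oner_eq0.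
have euler_L : (chi (-1) * p%:R) ^+ l./2 = chi l%:R.
  apply: (mulfI tau0); rewrite -tau2 -exprM -exprS mulrC -taul; congr (_ ^+ _); lia.
have l0 : l%:R != 0 :> 'F_p by rewrite Fp_nat_eq0 // dvdn_prime2.
apply: (legendre_inj l_prime l_odd); first exact: qchar_cases.
pose A : int := (legendre (p := p) (-1) * p%:Z) ^+ l./2 - legendre (p := p) l%:R.
have intr_eq0 (K : finFieldType) : l \in [pchar K] -> (A%:~R == 0 :> K) = (l %| `|A|)%N.
  by move=> lK; rewrite (dvdn_pcharf lK); case: A => m; rewrite ?NegzE ?rmorphN ?oppr_eq0 ?abszN.
have : A%:~R == 0 :> L.
  by rewrite /A rmorphB rmorphXn rmorphM /= subr_eq0 -/(chi _) euler_L.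
rewrite intr_eq0 // -(intr_eq0 'F_l) ?pchar_Fp // /A rmorphB rmorphXn /= subr_eq0.
by move/eqP.
Qed.

End GaussSum.

(** * Primes of the form a^2 + 2 b^2 *)

(** For odd [m], [sign4 m] and [sign8 m] are the Jacobi symbols of [-1] and of
    [2] modulo [m]. *)
Definition sign4 (m : nat) : int := if (m %% 4 == 1)%N then 1 else -1.
Definition sign8 (m : nat) : int :=
  if (m %% 8 == 1)%N || (m %% 8 == 7)%N then 1 else -1.

Lemma sign4M a b : odd (a * b) -> sign4 (a * b) = sign4 a * sign4 b.
Proof.
rewrite oddM => /andP[oa ob]; rewrite /sign4 -modnMm.
have : (a %% 4 = 1 \/ a %% 4 = 3)%N by lia.
have : (b %% 4 = 1 \/ b %% 4 = 3)%N by lia.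
by case=> -> [] ->.
Qed.

Lemma sign8M a b : odd (a * b) -> sign8 (a * b) = sign8 a * sign8 b.
Proof.
rewrite oddM => /andP[oa ob]; rewrite /sign8 -modnMm.
have : (a %% 8 = 1 \/ a %% 8 = 3 \/ a %% 8 = 5 \/ a %% 8 = 7)%N by lia.
have : (b %% 8 = 1 \/ b %% 8 = 3 \/ b %% 8 = 5 \/ b %% 8 = 7)%N by lia.
by case=> [->|[->|[->|->]]] [|[|[|]]] ->.
Qed.

Section Representation.

Variable p : nat.
Hypotheses (p_prime : prime p) (p_odd : odd p).
Local Notation chi := (legendre (p := p)).

Lemma legendre_prime_factors (f : nat -> int) m : (0 < m)%N -> f 1%N = 1 ->
  (forall a b, (a * b %| m)%N -> f (a * b)%N = f a * f b) ->
  (forall l, prime l -> (l %| m)%N -> chi l%:R = f l) -> chi m%:R = f m.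
Proof.
have [n] := ubnP m; elim: n m => // n IHn m ltm m0 f1 fM fl.
have [m1|m1] := leqP m 1; first by have -> : m = 1%N; [lia|rewrite f1 /legendre qchar1].
have lm := pdiv_dvd m; have lpr := pdiv_prime m1.
set l := pdiv m in lm lpr; have mE : (l * (m %/ l) = m)%N by rewrite mulnC divnK.
have dm : (m %/ l %| m)%N by rewrite -{2}mE dvdn_mull.
have fE : f m = f l * f (m %/ l)%N by rewrite -fM mE.
rewrite fE -[in LHS]mE natrM legendreM // fl //; congr (_ * _); apply: IHn => //.
- by apply: leq_trans (_ : m <= n)%N; [rewrite ltn_Pdiv ?prime_gt1|].
- by rewrite divn_gt0 ?prime_gt0 // dvdn_leq.
- by move=> a b ab; apply: fM; apply: dvdn_trans ab dm.
- by move=> r rpr rm; apply: fl => //; apply: dvdn_trans rm dm.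
Qed.

Variables a b : nat.
Hypothesis p_ab : p = (a ^ 2 + 2 * b ^ 2)%N.

Lemma repr_gt0 : (0 < a)%N /\ (0 < b)%N.
Proof.
have notsq m : p != (m * m)%N.
  apply/eqP => pm; have [m1|m1] := leqP m 1; first by have := prime_gt1 p_prime; nia.
  by move: p_prime; rewrite pm => /primeP[_ /(_ m (dvdn_mulr m (dvdnn m)))]; nia.
split; rewrite lt0n; apply/eqP => z0; move: p_ab; rewrite z0.
  by move=> e; move: p_odd; rewrite e; lia.
by rewrite muln0 addn0 => e; have := notsq a; rewrite {1}e eqxx.
Qed.

Lemma repr_lt : (a < p)%N /\ (b < p)%N.
Proof.
have [a0 b0] := repr_gt0; rewrite !(p_ab, expnS, expn0, muln1).
by move: a0 b0; clear; split; nia.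
Qed.

Lemma repr_coprime l : prime l -> (l %| a)%N -> (l %| b)%N -> False.
Proof.
move=> l_prime la lb; have [a0 b0] := repr_gt0.
have lp : (l %| p)%N by rewrite p_ab dvdn_add // ?dvdn_mull // expnS dvdn_mulr.
have /eqP lpE : l == p by rewrite -dvdn_prime2.
by have := dvdn_leq b0 lb; rewrite lpE leqNgt (proj2 repr_lt).
Qed.

Lemma repr_neq l : (l %| a)%N || (l %| b)%N -> p != l.
Proof.
have [a0 b0] := repr_gt0; have [ap bp] := repr_lt.
by case/orP=> [/(dvdn_leq a0)|/(dvdn_leq b0)] ll; rewrite gtn_eqF // (leq_ltn_trans ll).
Qed.

(** Modulo a prime factor [l] of [b], [p] is a square; modulo a prime factor of
    [a], it is twice a square. *)
Lemma legendre_dvd_b l : prime l -> odd l -> (l %| b)%N ->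
  chi l%:R = legendre (p := l) (chi (-1))%:~R.
Proof.
move=> l_prime l_odd lb; have pl := @repr_neq l; rewrite lb orbT in pl.
rewrite -(quadratic_reciprocity p_prime p_odd l_prime l_odd) ?pl //.
rewrite intrM legendreM // -[RHS]mulr1; congr (_ * _).
have b0 : b%:R = 0 :> 'F_l by apply/eqP; rewrite Fp_nat_eq0.
have -> : p%:Z%:~R = a%:R ^+ 2 :> 'F_l.
  by rewrite -pmulrn p_ab natrD natrM !natrX b0 expr0n mulr0 addr0.
rewrite /legendre (qchar_sqr (card_Fp_half l_prime l_odd)) // Fp_nat_eq0 //.
by apply/negP => la; apply: (repr_coprime l_prime).
Qed.

Lemma legendre_dvd_a l : prime l -> odd l -> (l %| a)%N ->
  chi l%:R = legendre (p := l) ((chi (-1))%:~R * 2).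
Proof.
move=> l_prime l_odd la; have pl := @repr_neq l; rewrite la in pl.
rewrite -(quadratic_reciprocity p_prime p_odd l_prime l_odd) ?pl //.
rewrite intrM !legendreM //; congr (_ * _).
have a0 : a%:R = 0 :> 'F_l by apply/eqP; rewrite Fp_nat_eq0.
have -> : p%:Z%:~R = 2 * b%:R ^+ 2 :> 'F_l.
  by rewrite -pmulrn p_ab natrD natrM !natrX a0 expr0n add0r.
rewrite legendreM // -[RHS]mulr1; congr (_ * _).
rewrite /legendre (qchar_sqr (card_Fp_half l_prime l_odd)) // Fp_nat_eq0 //.
by apply/negP => lb; apply: (repr_coprime l_prime).
Qed.

Lemma odd_a : odd a.
Proof. by move: p_odd; rewrite p_ab oddD oddM /= addbF oddX. Qed.

Lemma legendre_repr1 : (p %% 8 = 1)%N -> chi b%:R = 1 /\ chi a%:R = sign8 a.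
Proof.
move=> p8; have [a0 b0] := repr_gt0.
have chi1 : chi (-1) = 1 by rewrite legendre_minus1 // ifT //; lia.
split.
  apply: (legendre_prime_factors (f := fun=> 1)) => // l l_prime lb.
  have [l2|l_odd] := even_prime l_prime; first by rewrite l2 legendre_two // p8.
  by rewrite legendre_dvd_b // chi1 /legendre qchar1.
apply: legendre_prime_factors => // [x y xy|l l_prime la].
  by apply: sign8M; apply: dvdn_odd xy odd_a.
have l_odd := dvdn_odd la odd_a.
by rewrite legendre_dvd_a // chi1 mul1r legendre_two.
Qed.

Lemma legendre_repr3 : (p %% 8 = 3)%N ->
  chi b%:R = sign4 b /\ chi a%:R = sign4 a * sign8 a.
Proof.
move=> p8; have [a0 b0] := repr_gt0.
have chi1 : chi (-1) = -1 by rewrite legendre_minus1 // ifN //; lia.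
have odd_b : odd b.
  have : (a * a %% 8 = 1)%N.
    rewrite -modnMm; have : (a %% 8 = 1 \/ a %% 8 = 3 \/ a %% 8 = 5 \/ a %% 8 = 7)%N.
      by have := odd_a; lia.
    by case=> [->|[->|[->|->]]].
  case: (boolP (odd b)) => // eb; have [c bE] : exists c, b = (2 * c)%N by exists b./2; lia.
  by move: p_ab; rewrite bE; nia.
split.
  apply: legendre_prime_factors => // [x y xy|l l_prime lb].
    by apply: sign4M; apply: dvdn_odd xy odd_b.
  have l_odd := dvdn_odd lb odd_b.
  by rewrite legendre_dvd_b // chi1 legendre_minus1.
apply: (legendre_prime_factors (f := fun m => sign4 m * sign8 m)) => // [x y xy|l l_prime la].
  have o := dvdn_odd xy odd_a.
  by rewrite sign4M // sign8M //; ring.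
have l_odd := dvdn_odd la odd_a.
by rewrite legendre_dvd_a // chi1 legendreM // legendre_minus1 // legendre_two.
Qed.

Lemma Fp_repr : a%:R ^+ 2 = - (2 * b%:R ^+ 2) :> 'F_p.
Proof.
apply/eqP; rewrite -addr_eq0 -!natrX -natrM -natrD -p_ab; exact/eqP/pchar_Fp_0.
Qed.

(** In [F_p], [a ^+ 2 = - 2 * b ^+ 2]; raising this to the power [(p - 1) / 4]
    gives [chi a = 2 ^+ (2 * k) * chi b], with both characters known from
    [legendre_repr1]. Modulo 16, [a ^+ 2] then gives the parity of
    [k + b / 2]. *)
Lemma two_quartic k : p = (8 * k + 1)%N ->
  2 ^+ (2 * k) = (-1) ^+ (k + b./2) :> 'F_p.
Proof.
move=> pk; have p8 : (p %% 8 = 1)%N by lia.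
have [chib chia] := legendre_repr1 p8.
have Nk : (p./2 = 4 * k)%N by lia.
have bN : b%:R ^+ p./2 = 1 :> 'F_p by rewrite -legendre_euler // chib.
have aN : a%:R ^+ p./2 = (sign8 a)%:~R :> 'F_p by rewrite -legendre_euler // chia.
transitivity ((sign8 a)%:~R : 'F_p).
  rewrite -aN Nk (_ : 4 * k = 2 * (2 * k))%N; last by lia.
  rewrite [a%:R ^+ _]exprM Fp_repr -mulN1r exprMn [(2 * _) ^+ _]exprMn -exprM.
  rewrite (_ : 2 * (2 * k) = p./2)%N ?bN; last by lia.
  by rewrite mulr1 [(-1) ^+ _]exprM sqrrN !expr1n mul1r.
have oa := odd_a.
have [c bE] : exists c, b = (2 * c)%N.
  exists b./2; case: (boolP (odd b)) => ob; last by lia.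
  have [c bE] : exists c, b = (2 * c + 1)%N by exists b./2; lia.
  have [d aE] : exists d, a = (2 * d + 1)%N by exists a./2; lia.
  by exfalso; move: pk; rewrite p_ab bE aE; nia.
have bh : b./2 = c by lia.
have [e cE] : exists e, (c * c = c + 2 * e)%N.
  by have := odd_double_half (c * c - c); rewrite oddB ?oddM ?andbb ?addbb;
    [exists (c * c - c)./2; nia|nia].
have [t [r [aE r_odd]]] : exists t r, a = (8 * t + r)%N /\ (r = 1 \/ r = 3 \/ r = 5 \/ r = 7)%N.
  by exists (a %/ 8)%N, (a %% 8)%N; split; lia.
have sq : (a ^ 2 = 64 * (t * t) + 16 * (t * r) + r * r)%N by rewrite aE; ring.
have key : (8 * k + 1 = 64 * (t * t) + 16 * (t * r) + r * r + 2 * (4 * (c + 2 * e)))%N.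
  by rewrite -pk p_ab sq bE expnMn -[(c ^ 2)%N]mulnn cE.
rewrite bh /sign8 -signr_odd.
have -> : (a %% 8 = r)%N by lia.
by case: r_odd => [|[|[|]]] r_eq; rewrite r_eq in key * => /=;
  [rewrite (_ : odd (k + c) = false)|rewrite (_ : odd (k + c) = true)
  |rewrite (_ : odd (k + c) = true)|rewrite (_ : odd (k + c) = false)] => //; lia.
Qed.

End Representation.

Lemma repr_nat (p : nat) (s e : int) : p%:Z = s ^+ 2 + 2 * e ^+ 2 ->
  p = (`|s| ^ 2 + 2 * `|e| ^ 2)%N.
Proof. by move=> pse; lia. Qed.

Section Reduction.

Variable p : nat.
Hypothesis p_prime : prime p.

(** By the identity
    [p ^+ 2 = (c * s + 2 * d * e) ^+ 2 + 2 * (c * e - s * d) ^+ 2], a multiple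
    of [p] of the form [c * e - s * d] has to vanish. *)
Lemma repr_square_dvd (c d s e : int) : p%:Z = c ^+ 2 + 2 * d ^+ 2 ->
  p%:Z = s ^+ 2 + 2 * e ^+ 2 -> (p%:Z %| c * e - s * d)%Z -> c ^+ 2 = s ^+ 2.
Proof.
move=> pcd pse /dvdzP[t te]; have p_gt0 : 0 < p%:Z by rewrite ltz_nat prime_gt0.
have norm : p%:Z ^+ 2 = (c * s + 2 * (d * e)) ^+ 2 + 2 * (t * p%:Z) ^+ 2.
  by rewrite -te expr2 {1}pcd pse; ring.
have t0 : t = 0.
  have [//|t0] := eqVneq t 0; have t2 : 1 <= t ^+ 2 by rewrite -gtz0_ge1 exprn_even_gt0.
  have P0 : 0 < p%:Z ^+ 2 by rewrite exprn_gt0.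
  have : p%:Z ^+ 2 <= t ^+ 2 * p%:Z ^+ 2 by rewrite ler_peMl // ltW.
  move: (sqr_ge0 (c * s + 2 * (d * e))) norm P0; rewrite [(t * _) ^+ 2]exprMn.
  by move: (t ^+ 2 * p%:Z ^+ 2) (p%:Z ^+ 2) (_ ^+ 2); clear; lia.
have cesd : c * e = s * d by apply/eqP; rewrite -subr_eq0 te t0 mul0r.
apply: (mulIf (lt0r_neq0 p_gt0)); rewrite {1}pse pcd.
have -> : c ^+ 2 * (s ^+ 2 + 2 * e ^+ 2) = c ^+ 2 * s ^+ 2 + 2 * (c * e) ^+ 2 by ring.
by rewrite cesd; ring.
Qed.

Lemma repr_unique (c d s e : int) : p%:Z = c ^+ 2 + 2 * d ^+ 2 ->
  p%:Z = s ^+ 2 + 2 * e ^+ 2 -> s = c \/ s = - c.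
Proof.
move=> pcd pse; suff : c ^+ 2 = s ^+ 2.
  by move/eqP; rewrite eqf_sqr => /orP[]/eqP->; rewrite ?opprK; [left|right].
have : (p%:Z %| (c * e - s * d) * (c * e + s * d))%Z.
  apply/dvdzP; exists (e ^+ 2 - d ^+ 2).
  have -> : (c * e - s * d) * (c * e + s * d) = c ^+ 2 * e ^+ 2 - s ^+ 2 * d ^+ 2 by ring.
  have -> : c ^+ 2 = p%:Z - 2 * d ^+ 2 by rewrite pcd; ring.
  have -> : s ^+ 2 = p%:Z - 2 * e ^+ 2 by rewrite pse; ring.
  by ring.
rewrite dvdzE abszM absz_nat Euclid_dvdM // => /orP[] div.
  by apply: (repr_square_dvd pcd pse); rewrite dvdzE.
have pse' : p%:Z = (- s) ^+ 2 + 2 * e ^+ 2 by rewrite sqrrN.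
rewrite -[RHS]sqrrN; apply: (repr_square_dvd pcd pse').
by rewrite mulNr opprK dvdzE.
Qed.

Hypothesis p_odd : odd p.
Local Notation chi := (legendre (p := p)).

Lemma Fp_int_eq0 z : (z%:~R == 0 :> 'F_p) = (p%:Z %| z)%Z.
Proof.
rewrite dvdzE absz_nat; case: z => m; first exact: Fp_nat_eq0.
by rewrite NegzE rmorphN oppr_eq0 abszN; exact: Fp_nat_eq0.
Qed.

Lemma legendre_symbolE a : legendre_symbol a p = chi a%:~R.
Proof.
have cardF := card_Fp_half p_prime p_odd.
rewrite /legendre_symbol -Fp_int_eq0; case: eqP => [->|/eqP a0]; first by rewrite /legendre qchar0.
have modE (x : nat) : (x%:Z ^+ 2 == a %[mod p])%Z = (x%:R ^+ 2 == a%:~R :> 'F_p).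
  by rewrite eqz_mod_dvd -Fp_int_eq0 rmorphB rmorphXn /= subr_eq0.
case: existsP => [[x]|nox]; rewrite ?modE.
  move/eqP=> xa; rewrite -xa /legendre (qchar_sqr cardF) //.
  by apply: contraNneq a0 => x0; rewrite -xa x0 expr0n.
rewrite /legendre; have [a1|->//] := qchar_cases p./2 a0.
have [y y0 ay] := qchar_squareP cardF a1; case: nox.
have yp : (y < p)%N by rewrite -[X in (_ < X)%N](Fp_cast p_prime) ltn_ord.
by exists (Ordinal yp); rewrite modE /= natr_Zp ay.
Qed.

Lemma legendre_int (z : int) : chi z%:~R = (if z < 0 then chi (-1) else 1) * chi `|z|%N%:R.
Proof.
case: z => m; first by rewrite mul1r.
by rewrite (_ : (Negz m < 0) = true) // -legendreM // mulN1r.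
Qed.

(** Both sides have the same square, as [2 ^+ ((p - 1) / 2) = - 1]; and both are
    quadratic residues, whereas [-1] is not. *)
Lemma four_power_repr k (s d : int) : p = (8 * k + 3)%N ->
  p%:Z = s ^+ 2 + 2 * d ^+ 2 -> (4 %| s - (2 * k%:Z + 1))%Z -> (4 %| d - 1)%Z ->
  4 ^+ k * s%:~R = d%:~R :> 'F_p.
Proof.
move=> pk psd /dvdzP[t st] /dvdzP[u du].
have sE : s = 2 * k%:Z + 1 + 4 * t by lia.
have dE : d = 1 + 4 * u by lia.
have p8 : (p %% 8 = 3)%N by lia.
have [chid chis] := legendre_repr3 p_prime p_odd (repr_nat psd) p8.
have chi1 : chi (-1) = -1 by rewrite legendre_minus1 // ifN //; lia.
have chi_d : chi d%:~R = 1.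
  rewrite legendre_int chid chi1 /sign4; case: (boolP (d < 0)) => d0.
    by rewrite ifN //; lia.
  by rewrite ifT //; lia.
have chi_s : chi s%:~R = 1.
  rewrite legendre_int chis chi1 /sign4 /sign8.
  have key : s ^+ 2 = 8 * k%:Z + 1 - 16 * (u + 2 * u ^+ 2).
    by have := psd; rewrite dE pk PoszD PoszM; lia.
  have s8 : exists v, s = 8 * v + 1 \/ s = 8 * v + 3.
    have [j [ke|ko]] : exists j : int, k%:Z = 2 * j \/ k%:Z = 2 * j + 1.
      by exists (k./2)%:Z; lia.
    - have sw : s = 4 * (j + t) + 1 by lia.
      have sq : s ^+ 2 = 16 * (j + t) ^+ 2 + 8 * (j + t) + 1 by rewrite sw; ring.
      exists ((j + t) %/ 2)%Z; left; move: key; rewrite sq ke => key.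
      have : exists v, j + t = 2 * v by exists (j - u - 2 * u ^+ 2 - (j + t) ^+ 2); lia.
      by case=> v vE; rewrite sw vE mulKz //; ring.
    - have sw : s = 4 * (j + t) + 3 by lia.
      have sq : s ^+ 2 = 16 * (j + t) ^+ 2 + 24 * (j + t) + 9 by rewrite sw; ring.
      exists ((j + t) %/ 2)%Z; right; move: key; rewrite sq ko => key.
      have : exists v, j + t = 2 * v.
        by exists (j - u - 2 * u ^+ 2 - (j + t) ^+ 2 - (j + t)); lia.
      by case=> v vE; rewrite sw vE mulKz //; ring.
  case: s8 => v [] sv; case: (boolP (s < 0)) => s0.
  - by rewrite ifN ?ifT //; lia.
  - by rewrite ifT ?ifT //; lia.
  - by rewrite ifT ?ifN //; lia.
  - by rewrite ifN ?ifN //; lia.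
have two0 : 2 != 0 :> 'F_p by apply: two_neq0 (card_Fp_half p_prime p_odd).
have sd : s%:~R ^+ 2 = - (2 * d%:~R ^+ 2) :> 'F_p.
  apply/eqP; rewrite -addr_eq0.
  have -> : s%:~R ^+ 2 + 2 * d%:~R ^+ 2 = (s ^+ 2 + 2 * d ^+ 2)%:~R :> 'F_p.
    by rewrite rmorphD rmorphM !rmorphXn.
  by rewrite -psd; exact/eqP/pchar_Fp_0.
have twoN : 2 ^+ p./2 = -1 :> 'F_p.
  by rewrite -legendre_euler // legendre_two // ifN //; lia.
have : (4 ^+ k * s%:~R) ^+ 2 = d%:~R ^+ 2 :> 'F_p.
  have f4 : 4 = 2 ^+ 2 :> 'F_p by rewrite -natrX.
  rewrite exprMn sd f4 -!exprM mulrN mulrA -exprSr.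
  by rewrite (_ : (2 * (k * 2)).+1 = p./2)%N ?twoN; [ring|lia].
move/eqP; rewrite eqf_sqr => /orP[]/eqP // bad.
have := congr1 chi bad; rewrite legendreM // chi_s mulr1 -mulN1r legendreM // chi1 chi_d.
have f4 : (2 ^+ k) ^+ 2 = 4 ^+ k :> 'F_p.
  by rewrite -exprM mulnC exprM; congr (_ ^+ k); rewrite -natrX.
by rewrite -f4 [chi (_ ^+ 2)](qchar_sqr (card_Fp_half p_prime p_odd)) ?expf_neq0.
Qed.

End Reduction.

(** * The value at 7 sqrt 10 / 25 modulo p *)

Lemma rmorph_hlegendre (R S : comNzRingType) (f : {rmorphism R -> S}) (q x : R) n :
  f (hlegendre q n).[x] = (hlegendre (f q) n).[f x].
Proof.
suff [] : f (hlegendre q n).[x] = (hlegendre (f q) n).[f x] /\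
  f (hlegendre q n.+1).[x] = (hlegendre (f q) n.+1).[f x] by [].
elim: n => [|n [IH1 IH2]]; first by rewrite /= !hornerC !hornerX rmorph1.
split=> //; rewrite !hlegendreS !hornerD !hornerN !hornerZ !hornerM !hornerX -IH1 -IH2.
ring.
Qed.

Lemma hlegendre_legendre_poly (F : numFieldType) (x y : F) n :
  (hlegendre (y ^+ 2) n).[y * x] = (n`!)%:R * y ^+ n * (legendre_poly F n).[x].
Proof.
suff [] : (hlegendre (y ^+ 2) n).[y * x] = (n`!)%:R * y ^+ n * (legendre_poly F n).[x] /\
  (hlegendre (y ^+ 2) n.+1).[y * x] = (n.+1`!)%:R * y ^+ n.+1 * (legendre_poly F n.+1).[x] by [].
elim: n => [|n [IH1 IH2]].
  by rewrite /= !hornerC !hornerX !mulr1 mul1r.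
split=> //; set P2 := (legendre_poly F n.+2).[x].
rewrite hlegendreS hornerD hornerN !hornerZ hornerM hornerX IH1 IH2.
set P1 := (legendre_poly F n.+1).[x]; set P0 := (legendre_poly F n).[x].
have rec : n.+2%:R * P2 = (2 * n.+1 + 1)%:R * (x * P1) - n.+1%:R * P0.
  by rewrite -hornerZ legendre_polyP hornerD hornerN !hornerZ hornerM hornerX.
have -> : (n.+2`!)%:R * y ^+ n.+2 * P2 = (n.+1`!)%:R * y ^+ n.+2 * (n.+2%:R * P2).
  by rewrite factS natrM; ring.
rewrite rec factS !natrM natrD natrM !exprS !mulrS; ring.
Qed.

Section Transfer.

Variable p : nat.
Hypothesis p_prime : prime p.

Lemma Rp_frac (w : int) D : coprime D p -> Rp p (w%:~R / D%:R).
Proof.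
move=> Dp; have D0 : (0 < D)%N.
  by move: Dp; case: D => //; rewrite /coprime gcd0n => /eqP p1; move: p_prime; rewrite p1.
set r := _ / _; rewrite /Rp coprime_sym prime_coprime //; apply/negP => pden.
have e : numq r * D%:Z = w * denq r.
  apply: (intr_inj (R := rat)); rewrite !rmorphM /= numqE mulrAC; congr (_ * _).
  by rewrite /r divfK // pnatr_eq0 -lt0n.
have : (p %| `|numq r| * D)%N.
  by rewrite -[D]absz_nat -abszM e abszM dvdn_mull.
have pD : ~~ (p %| D)%N by rewrite -prime_coprime // coprime_sym.
rewrite Euclid_dvdM // (negPf pD) orbF => pnum.
have := coprime_num_den r; rewrite /coprime => /eqP g1.
have : (p %| gcdn `|numq r| `|denq r|)%N by rewrite dvdn_gcd pnum.
by rewrite g1 dvdn1 => /eqP p1; move: p_prime; rewrite p1.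
Qed.

(** The two conclusions serve the two parities of the degree. *)
Lemma eqmod_frac (a X : int) D : coprime D p -> (p%:Z %| a - D%:Z * X)%Z ->
  eqmod_sqrt10 p (a%:~R / D%:R) X%:~R /\
  eqmod_sqrt10 p (a%:~R / D%:R * sqrtC 10) (X%:~R * sqrtC 10).
Proof.
move=> Dp /dvdzP[w we]; have Rpw := Rp_frac w Dp.
have Rp0 : Rp p 0 by have := Rp_frac 0 Dp; rewrite mul0r.
have D0 : D%:R != 0 :> algC.
  by rewrite pnatr_eq0; apply: contraTneq Dp => ->; rewrite /coprime gcd0n neq_ltn prime_gt1 ?orbT.
have e : a%:~R / D%:R - X%:~R = p%:R * ratr (w%:~R / D%:R) :> algC.
  rewrite fmorph_div rmorph_int rmorph_nat; apply: (mulIf D0).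
  rewrite mulrBl mulrA !divfK //; move/(congr1 (fun z : int => z%:~R : algC)): we.
  by rewrite rmorphB !rmorphM /= -!pmulrn [p%:R * _]mulrC [X%:~R * _]mulrC.
split; [exists (ratr (w%:~R / D%:R))|exists (ratr (w%:~R / D%:R) * sqrtC 10)].
- by exists (w%:~R / D%:R), 0; split; rewrite // rmorph0 mul0r addr0.
- exact: e.
- by exists 0, (w%:~R / D%:R); split; rewrite // rmorph0 add0r.
- by rewrite -mulrBl e -mulrA.
Qed.

Hypothesis p_gt5 : (5 < p)%N.

Lemma p_odd_gt5 : odd p.
Proof. by have [p2|//] := even_prime p_prime; lia. Qed.

Lemma coprime_fact_p n D : (n < p)%N -> coprime D p -> coprime (n`! * D) p.
Proof.
move=> np Dp; rewrite coprimeMl Dp andbT.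
elim: n np => [|n IHn] np; first exact: coprime1n.
by rewrite factS coprimeMl IHn ?(ltnW np) // andbT coprime_sym prime_coprime // gtnNdvd.
Qed.

Lemma coprime10p : coprime 10 p.
Proof.
rewrite coprime_sym prime_coprime // (_ : 10 = 2 * 5)%N // Euclid_dvdM //.
by rewrite !gtnNdvd // (ltn_trans _ p_gt5).
Qed.

(** Up to the factor [n! * (10 * sqrt 10) ^+ n], where [n] is the degree, this is
    the value at [7 * sqrt 10 / 25]: indeed [28 = 10 * sqrt 10 * (7 * sqrt 10 / 25)]
    and [1000 = (10 * sqrt 10) ^+ 2]. *)
Definition legendre_num : int := (hlegendre 1000 (p %/ 6)).[28].

Lemma legendre_poly_eta :
  legendre_num%:~R = ((p %/ 6)`!)%:R * (10 * sqrtC 10) ^+ (p %/ 6)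
            * (legendre_poly algC (p %/ 6)).[7 * sqrtC 10 / 25].
Proof.
have sq10 : sqrtC 10 ^+ 2 = 10 :> algC by rewrite sqrtCK.
rewrite -hlegendre_legendre_poly.
have -> : (10 * sqrtC 10) ^+ 2 = 1000 :> algC by rewrite exprMn sq10; ring.
have -> : 10 * sqrtC 10 * (7 * sqrtC 10 / 25) = 28 :> algC.
  transitivity (70 * sqrtC 10 ^+ 2 / 25 : algC); first by field.
  by rewrite sq10; field.
by rewrite /legendre_num rmorph_hlegendre !rmorph_nat.
Qed.

Lemma legendre_poly_even r : (p %/ 6 = 2 * r)%N ->
  (legendre_poly algC (p %/ 6)).[7 * sqrtC 10 / 25] = legendre_num%:~R / ((p %/ 6)`! * 1000 ^ r)%:R.
Proof.
move=> nr; have sq10 : sqrtC 10 ^+ 2 = 10 :> algC by rewrite sqrtCK.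
have D0 : ((p %/ 6)`! * 1000 ^ r)%:R != 0 :> algC.
  by rewrite pnatr_eq0 muln_eq0 negb_or -!lt0n fact_gt0 expn_gt0.
apply: (mulIf D0); rewrite divfK // legendre_poly_eta natrM natrX mulrC; congr (_ * _ * _).
rewrite nr exprM; congr (_ ^+ r); rewrite exprMn sq10; ring.
Qed.

Lemma legendre_poly_odd r : (p %/ 6 = 2 * r + 1)%N ->
  (legendre_poly algC (p %/ 6)).[7 * sqrtC 10 / 25]
  = legendre_num%:~R / ((p %/ 6)`! * (1000 ^ r * 100))%:R * sqrtC 10.
Proof.
move=> nr; have sq10 : sqrtC 10 ^+ 2 = 10 :> algC by rewrite sqrtCK.
have D0 : ((p %/ 6)`! * (1000 ^ r * 100))%:R != 0 :> algC.
  by rewrite pnatr_eq0 !muln_eq0 !negb_or -!lt0n fact_gt0 expn_gt0.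
apply: (mulIf D0); rewrite [RHS]mulrAC divfK // legendre_poly_eta !natrM natrX.
have -> : (10 * sqrtC 10) ^+ (p %/ 6) = 1000 ^+ r * (10 * sqrtC 10) :> algC.
  rewrite [X in _ ^+ X]nr exprD expr1 exprM; congr (_ ^+ r * _).
  by rewrite exprMn sq10; ring.
set P := _.[_]; transitivity ((p %/ 6)`!%:R * 1000 ^+ r * 10 * P * sqrtC 10 ^+ 2).
  by rewrite sq10; ring.
by ring.
Qed.

Local Notation chi := (legendre (p := p)).

Lemma legendre_num_Fp : exists2 b, p./2 = (3 * (p %/ 6) + 2 * b)%N &
  ((p %/ 6)`!)%:R * (cubic_sum 'F_p p./2)%:~R
  = - ((chi 2)%:~R * 10 ^+ b * (-1) ^+ (p %/ 6) * legendre_num%:~R) :> 'F_p.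
Proof.
have p_odd := p_odd_gt5; have cardF := card_Fp_half p_prime p_odd.
have charF j : (0 < j < #|'F_p|)%N -> j%:R != 0 :> 'F_p.
  by rewrite card_Fp // => /andP[j0 jp]; rewrite Fp_nat_eq0 // gtnNdvd.
have p3 : ~~ (3 %| p)%N by rewrite dvdn_prime2 //; apply/eqP => p3; move: p_gt5; rewrite -p3.
have n0 : (0 < p %/ 6)%N by lia.
set n := (p %/ 6)%N in n0 *.
have n_mod : 36 * (n%:R * (n%:R + 1)) + 5 = 0 :> 'F_p.
  have -> : 36 * (n%:R * (n%:R + 1)) + 5 = ((6 * n + 1) * (6 * n + 5))%:R :> 'F_p.
    by ring.
  apply/eqP; rewrite Fp_nat_eq0 // Euclid_dvdM //.
  have : (p = 6 * n + 1 \/ p = 6 * n + 5)%N by rewrite /n; lia.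
  by case=> <-; rewrite dvdnn ?orbT.
have [h [b [N_nh h_Nb b_lt3]]] : exists h b,
    [/\ p./2 = (n + 2 * h)%N, (3 * h = p./2 + b)%N & (b < 3)%N].
  have : (p = 6 * n + 1 \/ p = 6 * n + 5)%N by rewrite /n; lia.
  by case=> pn; [exists n, 0%N|exists n.+1, 1%N]; split; lia.
exists b; first by lia.
rewrite (cubic_sum_hlegendre cardF charF N_nh h_Nb n0 b_lt3 n_mod) legendre_euler //.
by rewrite /legendre_num rmorph_hlegendre !rmorph_nat.
Qed.

End Transfer.

Section Cases.

Variable p : nat.
Hypotheses (p_prime : prime p) (p_gt5 : (5 < p)%N).
Local Notation chi := (legendre (p := p)).
Local Notation n := (p %/ 6)%N.
Local Notation value := (legendre_poly algC n).[7 * sqrtC 10 / 25].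

Let p_odd : odd p := p_odd_gt5 p_prime p_gt5.

Lemma eqmod_value_even r X : n = (2 * r)%N ->
  (legendre_num p)%:~R = (n`!)%:R * 1000 ^+ r * X%:~R :> 'F_p -> eqmod_sqrt10 p value X%:~R.
Proof.
move=> nr e; rewrite (legendre_poly_even nr).
apply: (proj1 (eqmod_frac p_prime _ _)).
  apply: coprime_fact_p => //; first by apply: ltn_Pdiv => //; lia.
  by rewrite coprimeXl // (_ : 1000 = 10 ^ 3)%N // coprimeXl // coprime10p.
rewrite -Fp_int_eq0 // rmorphB rmorphM /= -pmulrn natrM natrX e subrr.
exact: eqxx.
Qed.

Lemma eqmod_value_odd r X : n = (2 * r + 1)%N ->
  (legendre_num p)%:~R = (n`!)%:R * (1000 ^+ r * 100) * X%:~R :> 'F_p ->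
  eqmod_sqrt10 p value (X%:~R * sqrtC 10).
Proof.
move=> nr e; rewrite (legendre_poly_odd nr).
apply: (proj2 (eqmod_frac p_prime _ _)).
  apply: coprime_fact_p => //; first by apply: ltn_Pdiv => //; lia.
  rewrite coprimeMl (_ : 1000 = 10 ^ 3)%N // (_ : 100 = 10 ^ 2)%N //.
  by rewrite !coprimeXl // coprime10p.
rewrite -Fp_int_eq0 // rmorphB rmorphM /= -pmulrn !natrM natrX e subrr.
exact: eqxx.
Qed.

Lemma ten_neq0 : 10 != 0 :> 'F_p.
Proof. by rewrite Fp_nat_eq0 // -prime_coprime // coprime_sym coprime10p. Qed.

Lemma five_euler : (legendre_symbol 5 p)%:~R = 5 ^+ p./2 :> 'F_p.
Proof. by rewrite legendre_symbolE // legendre_euler. Qed.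

Lemma expFp_double x : x != 0 :> 'F_p -> x ^+ p./2 * x ^+ p./2 = 1.
Proof.
by move=> x0; rewrite -exprD addnn (expf_double_half (card_Fp_half p_prime p_odd)).
Qed.

Lemma five_neq0 : 5 != 0 :> 'F_p.
Proof. by apply: contraNneq ten_neq0 => e; rewrite (natrM _ 2 5) e mulr0. Qed.

Lemma signz (z : int) : (-1) ^ z = ((-1) ^+ `|z|)%:~R :> algC.
Proof.
rewrite rmorphXn rmorphN1; case: z => m //.
by rewrite -[LHS]/(((-1) ^+ m.+1)^-1) -exprVn invrN1.
Qed.

Lemma legendre_minus2 : chi (- 2%:R) = chi (-1) * chi 2.
Proof. by rewrite -legendreM // mulN1r. Qed.

(** As [c] is odd and [p = 1 mod 8], [d] is even; so [d / 2] and its absolute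
    value can be exchanged as exponents of [-1]. *)
Lemma repr_half_absz k (c d : int) : p = (8 * k + 1)%N ->
  p%:Z = c ^+ 2 + 2 * d ^+ 2 -> (4 %| c - 1)%Z -> (`|(d %/ 2)%Z| = `|d|./2)%N.
Proof.
clear; move=> pk pcd /dvdzP[u cu].
have cE : c = 4 * u + 1 by rewrite mulrC -cu subrK.
have [v [dv|dv]] : exists v, d = 2 * v \/ d = 2 * v + 1.
  by exists (d %/ 2)%Z; clear; lia.
  by rewrite dv; clear; lia.
by move: pcd; rewrite dv cE pk PoszD PoszM; clear; lia.
Qed.

(** If [p = 8 * k + 1] then [s = 2 * k - 1 mod 4] and [c = 1 mod 4] give
    [- s = (-1) ^+ k * c]. The powers of 10 contribute [10 ^+ (2 * k)]; its
    factor [2 ^+ (2 * k)] is given by [two_quartic] and cancels [(-1) ^+ k]. *)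
Lemma value_mod8_1 (c d : int) : p = 1 %[mod 8] -> p%:Z = c ^+ 2 + 2 * d ^+ 2 ->
  (4 %| c - 1)%Z ->
  eqmod_sqrt10 p value ((-1) ^ (d %/ 2)%Z * (legendre_symbol 5 p)%:~R
             * 5 ^+ ((p - 1) %/ 4) * (2 * c%:~R)).
Proof.
move=> p8; have [k pk] : exists k, p = (8 * k + 1)%N by exists (p %/ 8)%N; lia.
have Nk : (p./2 = 2 * k + 2 * k)%N by lia.
have pk4 : ((p - 1) %/ 4 = 2 * k)%N by lia.
have chi1 : chi (-1) = 1 by rewrite legendre_minus1 // ifT //; lia.
have chi2 : chi 2 = 1 by rewrite legendre_two // ifT //; lia.
have [b Nb main] := legendre_num_Fp p_prime p_gt5.
have [r nr] : exists r, n = (2 * r)%N by exists (n./2); lia.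
have br : (b + 3 * r = 2 * k)%N by lia.
have cardF := card_Fp_half p_prime p_odd.
have chim2 : qchar p./2 (- 2%:R : 'F_p) = 1 by rewrite -/(legendre _) legendre_minus2 chi1 chi2.
have [s [e [m [cub pse s16]]]] := cubic_sum_norm cardF chim2.
rewrite card_Fp // in pse s16.
have sk : s = 2 * k%:Z - 1 - 4 * m.
  move: s16; rewrite -/(legendre (-1)) -/(legendre 2) chi1 chi2 pk.
  by clear; lia.
move=> pcd c1; have sc : - s = (-1) ^+ k * c.
  move: (repr_unique p_prime pcd pse) c1 sk (odd_double_half k); rewrite -signr_odd.
  by clear; case: (odd k) => /= ? ? ? ?; rewrite ?expr0 ?expr1; lia.
have dh := repr_half_absz pk pcd c1.
pose X := (-1) ^+ (`|d|./2) * legendre_symbol 5 p * 5 ^+ (2 * k) * (2 * c).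
have -> : (-1) ^ (d %/ 2)%Z * (legendre_symbol 5 p)%:~R * 5 ^+ ((p - 1) %/ 4) * (2 * c%:~R)
    = X%:~R :> algC.
  by rewrite signz dh pk4 /X !rmorphM /= !rmorphXn.
apply: (eqmod_value_even nr).
apply: (mulfI (expf_neq0 b ten_neq0)).
have quartic := two_quartic p_prime p_odd (repr_nat pcd) pk.
have five4 : 5 ^+ (2 * k) * 5 ^+ (2 * k) * 5 ^+ p./2 = 1 :> 'F_p.
  by rewrite -exprD -Nk expFp_double ?five_neq0.
have ten : 10 ^+ b * 1000 ^+ r = 2 ^+ (2 * k) * 5 ^+ (2 * k) :> 'F_p.
  rewrite -exprMn (_ : 1000 = 10 ^+ 3); last by rewrite -natrX.
  rewrite -exprM -exprD br.
  by congr (_ ^+ _); rewrite -natrM.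
have -> : 10 ^+ b * ((n`!)%:R * 1000 ^+ r * X%:~R) = (n`!)%:R * (2 * (- s)%:~R) :> 'F_p.
  transitivity ((n`!)%:R * (10 ^+ b * 1000 ^+ r) * X%:~R : 'F_p); first by ring.
  rewrite ten -mulrA; congr (_ * _).
  rewrite /X !rmorphM /= !rmorphXn five_euler sc rmorphM rmorphXn /= rmorphN1 quartic exprD.
  transitivity ((-1) ^+ k * ((-1) ^+ (`|d|./2)) ^+ 2 * (5 ^+ (2 * k) * 5 ^+ (2 * k) * 5 ^+ p./2)
    * (2 * c%:~R) : 'F_p); first by ring.
  by rewrite sqrr_sign five4; ring.
move: main; rewrite cub chi2 nr exprM sqrrN !expr1n => main.
transitivity (- ((2 * r)`!%:R * (2 * s)%:~R) : 'F_p); first by rewrite main; ring.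
by rewrite rmorphM rmorphN /=; ring.
Qed.

(** If [p = 8 * k + 3] then [d = 4 ^+ k * s] in [F_p], so that the remaining power
    of 2 is [2 ^+ (4 * k + 1)], that is [chi 2 = - 1]. *)
Lemma value_mod8_3 (c d : int) : p = 3 %[mod 8] -> p%:Z = c ^+ 2 + 2 * d ^+ 2 ->
  (4 %| d - 1)%Z ->
  eqmod_sqrt10 p value ((legendre_symbol 5 p)%:~R * 5 ^+ ((p - 3) %/ 4)
             * (2 * d%:~R * sqrtC 10)).
Proof.
move=> p8; have [k pk] : exists k, p = (8 * k + 3)%N by exists (p %/ 8)%N; lia.
have Nk : (p./2 = 2 * k + 1 + 2 * k)%N by lia.
have pk4 : ((p - 3) %/ 4 = 2 * k)%N by lia.
have chi1 : chi (-1) = -1 by rewrite legendre_minus1 // ifN //; lia.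
have chi2 : chi 2 = -1 by rewrite legendre_two // ifN //; lia.
have [b Nb main] := legendre_num_Fp p_prime p_gt5.
have [r nr] : exists r, n = (2 * r + 1)%N by exists (n./2); lia.
have br : (b + (3 * r + 2) = 2 * k + 1)%N by lia.
have cardF := card_Fp_half p_prime p_odd.
have chim2 : qchar p./2 (- 2%:R : 'F_p) = 1 by rewrite -/(legendre _) legendre_minus2 chi1 chi2.
have [s [e [m [cub pse s16]]]] := cubic_sum_norm cardF chim2.
rewrite card_Fp // in pse s16.
have sk : s = 2 * k%:Z + 1 - 4 * m.
  move: s16; rewrite -/(legendre (-1)) -/(legendre 2) chi1 chi2 pk.
  by clear; lia.
move=> pcd d1; have psd : p%:Z = s ^+ 2 + 2 * d ^+ 2.
  by rewrite pcd; have [->|->] := repr_unique p_prime pcd pse; rewrite ?sqrrN.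
have four : 4 ^+ k * s%:~R = d%:~R :> 'F_p.
  apply: four_power_repr pk psd _ d1 => //.
  by apply/dvdzP; exists (- m); rewrite sk; ring.
pose X := legendre_symbol 5 p * 5 ^+ (2 * k) * (2 * d).
have -> : (legendre_symbol 5 p)%:~R * 5 ^+ ((p - 3) %/ 4) * (2 * d%:~R * sqrtC 10)
    = X%:~R * sqrtC 10 :> algC.
  by rewrite pk4 [LHS]mulrA; congr (_ * _); rewrite /X !rmorphM /= !rmorphXn.
apply: (eqmod_value_odd nr).
apply: (mulfI (expf_neq0 b ten_neq0)).
have twoN : 2 ^+ p./2 = -1 :> 'F_p by rewrite -legendre_euler // chi2.
have ten : 10 ^+ b * (1000 ^+ r * 100) = 2 ^+ (2 * k + 1) * 5 ^+ (2 * k + 1) :> 'F_p.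
  rewrite -exprMn (_ : 1000 = 10 ^+ 3); last by rewrite -natrX.
  rewrite (_ : 100 = 10 ^+ 2); last by rewrite -natrX.
  rewrite -exprM -!exprD br.
  by congr (_ ^+ _); rewrite -natrM.
have -> : 10 ^+ b * ((n`!)%:R * (1000 ^+ r * 100) * X%:~R) = (n`!)%:R * (2 * (- s)%:~R) :> 'F_p.
  transitivity ((n`!)%:R * (10 ^+ b * (1000 ^+ r * 100)) * X%:~R : 'F_p); first by ring.
  rewrite ten -mulrA; congr (_ * _).
  rewrite /X !rmorphM /= !rmorphXn five_euler -four rmorphN /=.
  have f4 : 4 ^+ k = 2 ^+ (2 * k) :> 'F_p by rewrite exprM; congr (_ ^+ k); rewrite -natrX.
  transitivity (2 ^+ p./2 * (5 ^+ p./2 * 5 ^+ p./2) * (2 * s%:~R) : 'F_p).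
    by rewrite {2 3}Nk f4 !exprD; ring.
  by rewrite expFp_double ?five_neq0 // twoN; ring.
move: main; rewrite cub chi2 nr exprD exprM sqrrN !expr1n => main.
transitivity (- ((2 * r + 1)`!%:R * (2 * s)%:~R) : 'F_p).
  by rewrite main; ring.
by rewrite rmorphM rmorphN /=; ring.
Qed.

Lemma value_mod8_57 : p = 5 %[mod 8] \/ p = 7 %[mod 8] -> eqmod_sqrt10 p value 0.
Proof.
move=> p8; have cardF := card_Fp_half p_prime p_odd.
have chim2 : qchar p./2 (- 2%:R : 'F_p) = -1.
  rewrite -/(legendre _) legendre_minus2 legendre_minus1 // legendre_two //.
  by case: p8 => p8; [rewrite ifT ?ifN //; lia|rewrite ifN ?ifT //; lia].
have [b _ main] := legendre_num_Fp p_prime p_gt5.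
have two0 := two_neq0 cardF.
have eta0 : (legendre_num p)%:~R = 0 :> 'F_p.
  move/eqP: main; rewrite (cubic_sum_eq0 cardF chim2) mulr0 eq_sym oppr_eq0 mulf_eq0.
  rewrite legendre_euler // -[X in X || _]negbK !mulf_neq0 ?expf_neq0 ?ten_neq0 ?signr_eq0 //=.
    by move/eqP.
  by rewrite oppr_eq0 oner_eq0.
have [r [nr|nr]] : exists r, (n = 2 * r)%N \/ (n = 2 * r + 1)%N by exists n./2; lia.
  by apply: (eqmod_value_even (X := 0) nr); rewrite eta0 mulr0.
rewrite -[X in eqmod_sqrt10 _ _ X](mul0r (sqrtC 10)).
by apply: (eqmod_value_odd (X := 0) nr); rewrite eta0 mulr0.
Qed.

End Cases.

Unset Implicit Arguments.

Theorem corollary2p2 (p : nat) (p_prime : prime p) (p_gt5 : (5 < p)%N) :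
  [/\ forall c d : int,
        p = 1 %[mod 8] -> p%:Z = c ^+ 2 + 2 * d ^+ 2 -> (4 %| c - 1)%Z ->
        eqmod_sqrt10 p
          (legendre_poly algC (p %/ 6)).[7 * sqrtC 10 / 25]
          ((-1) ^ (d %/ 2)%Z * (legendre_symbol 5 p)%:~R
             * 5 ^+ ((p - 1) %/ 4) * (2 * c%:~R)),
      forall c d : int,
        p = 3 %[mod 8] -> p%:Z = c ^+ 2 + 2 * d ^+ 2 -> (4 %| d - 1)%Z ->
        eqmod_sqrt10 p
          (legendre_poly algC (p %/ 6)).[7 * sqrtC 10 / 25]
          ((legendre_symbol 5 p)%:~R * 5 ^+ ((p - 3) %/ 4)
             * (2 * d%:~R * sqrtC 10))
    & p = 5 %[mod 8] \/ p = 7 %[mod 8] ->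
        eqmod_sqrt10 p
          (legendre_poly algC (p %/ 6)).[7 * sqrtC 10 / 25] 0].
Proof.
split=> [c d|c d|].
- exact: value_mod8_1.
- exact: value_mod8_3.
- exact: value_mod8_57.
Qed.
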